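(* Let $\psi\in L^2(\mathbb{R})$ be a nonzero function with finite time resolution $\Delta_t$ and finite frequency resolution $\Delta_\omega$. Then the scaled function $t\mapsto \psi\left(\sqrt{\Delta_t/\Delta_\omega}\; t\right)$ achieves isoresolution, i.e. its time resolution equals its frequency resolution.
   Context: The Fourier transform is $F(\omega) = \int_{-\infty}^{\infty} f(t) e^{-j\omega t}\,dt$ with $j^2=-1$, extended to $L^2(\mathbb{R})$ in the usual (Plancherel) way. For a nonzero $f\in L^2(\mathbb{R})$ with Fourier transform $F$ and energy $E=\int_{-\infty}^{\infty}|f(t)|^2\,dt$, the time and frequency moments are $\overline{t^n} = \frac1E\int_{-\infty}^\infty t^n|f(t)|^2\,dt$ and $\overline{\omega^n} = \frac{1}{2\pi E}\int_{-\infty}^\infty \omega^n|F(\omega)|^2\,d\omega$. The time resolution and frequency resolution of $f$ are the standard deviations $\Delta_t = \sqrt{\overline{(t-\overline t)^2}}$ and $\Delta_\omega = \sqrt{\overline{(\omega-\overline\omega)^2}}$, where the overline denotes averaging against the densities $|f(t)|^2/E$ and $|F(\omega)|^2/(2\pi E)$ respectively; they are finite when the second moments $\overline{t^2}$ and $\overline{\omega^2}$ are finite. A function achieves isoresolution if $\Delta_t=\Delta_\omega$ for that function. *)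

(* Defs.v *)
From HB Require Import structures.
From mathcomp Require Import all_boot all_order all_algebra.
From mathcomp Require Import all_classical all_reals all_analysis.
From mathcomp Require Import complex.

Set Implicit Arguments.
Unset Strict Implicit.
Unset Printing Implicit Defensive.

Import Order.TTheory GRing.Theory Num.Theory.
Import numFieldNormedType.Exports.
Import ComplexField.Normc.

Local Open Scope classical_set_scope.
Local Open Scope ring_scope.
Local Open Scope complex_scope.

Section Signals.
Context {R : realType}.
Implicit Types (f F : R -> R[i]).

Local Notation mu := (@lebesgue_measure R).

(* MathComp-Analysis has no measurable or normed structure on [R[i]], so
   measurability, integrability and integrals are taken componentwise. *)
Definition cmeasurable f : Prop :=
  measurable_fun [set: R] (fun t => complex.Re (f t)) /\
  measurable_fun [set: R] (fun t => complex.Im (f t)).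

Definition cintegrable f : Prop :=
  mu.-integrable [set: R] (fun t => (complex.Re (f t))%:E) /\
  mu.-integrable [set: R] (fun t => (complex.Im (f t))%:E).

Definition cintegral f : R[i] :=
  Rintegral mu [set: R] (fun t => complex.Re (f t)) +i*
  Rintegral mu [set: R] (fun t => complex.Im (f t)).

Definition energy f : \bar R := (\int[mu]_t (normc (f t) ^+ 2)%:E)%E.

(* Elements of L^2(R) are represented by Borel functions; "zero" means zero as
   an element of L^2, hence almost everywhere. *)
Definition square_integrable f : Prop := cmeasurable f /\ (energy f < +oo)%E.

Definition nonzero f : Prop := ~ {ae mu, forall t, f t = 0}.

(* Only meaningful when [f] is integrable; the second factor is e^{-j w t}. *)
Definition fourier_integral f : R -> R[i] := fun w =>
  cintegral (fun t => f t * (cos (w * t) -i* sin (w * t))).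

Definition cvg_L2 (f_ : nat -> R -> R[i]) f : Prop :=
  energy (fun t => f_ n t - f t) @[n --> \oo] --> 0%E.

(* [F] is the value at [f] of the continuous extension to L^2 of
   [fourier_integral], from the intersection of L^1 and L^2, dense in L^2. *)
Definition is_fourier f F : Prop :=
  square_integrable F /\
  forall f_ : nat -> R -> R[i],
    (forall n, cintegrable (f_ n)) ->
    (forall n, square_integrable (f_ n)) ->
    cvg_L2 f_ f -> cvg_L2 (fun n => fourier_integral (f_ n)) F.

(* By Plancherel's theorem such an [F] exists, uniquely up to a null set, for
   every square-integrable [f]; nothing below depends on its values on a null
   set. The default value is irrelevant. *)
Definition fourier f : R -> R[i] := xget (fun=> 0) [set F | is_fourier f F].

(* Averages against |f(t)|^2 / E and |F(w)|^2 / (2 pi E). *)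
Definition time_average f (h : R -> R) : \bar R :=
  (((fine (energy f))^-1)%:E * \int[mu]_t (h t * normc (f t) ^+ 2)%:E)%E.

Definition frequency_average f (h : R -> R) : \bar R :=
  (((2 * pi * fine (energy f))^-1)%:E *
   \int[mu]_w (h w * normc (fourier f w) ^+ 2)%:E)%E.

Definition time_moment f (n : nat) : \bar R := time_average f (fun t => t ^+ n).

Definition frequency_moment f (n : nat) : \bar R :=
  frequency_average f (fun w => w ^+ n).

(* If the first moment does not exist or is infinite, the second moment about
   any point is infinite, so the resolution is +oo whatever real number [fine]
   returns; otherwise [fine] returns the mean. *)
Definition time_resolution f : \bar R :=
  sqrte (time_average f (fun t => (t - fine (time_moment f 1)) ^+ 2)).

Definition frequency_resolution f : \bar R :=
  sqrte (frequency_average f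
           (fun w => (w - fine (frequency_moment f 1)) ^+ 2)).

(* The first three conditions say that the resolutions of [f] are defined and
   finite, so that the equality is not one between junk or infinite values. *)
Definition isoresolution f : Prop :=
  [/\ square_integrable f, nonzero f, time_resolution f \is a fin_num &
      time_resolution f = frequency_resolution f].

End Signals.

(* Main.v *)
(** The Fourier transform of [psi (a * t)] is [a^-1 * F (w / a)], so scaling by
    [a] divides the time resolution by [a] and multiplies the frequency
    resolution by [a]; the two agree when [a ^+ 2] is the quotient of the
    resolutions of [psi].

    The substance lies in the quotient being positive: this requires that the
    Fourier transform of [psi] in L^2 exists and is not zero almost everywhere,
    that is, the boundedness and the injectivity of the Fourier transform on
    L^2. Both follow from one identity for real integrable [u] and [v]: with
    cosine and sine transforms C and S,
      [int e^{-e|w|} (C_u C_v + S_u S_v) dw = int int u(s) v(t) P_e(s - t) dt ds],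
    where [P_e(x) = 2 e / (e^2 + x^2)] has mass [2 pi]. For [v = u], Schur's
    test and [e -> 0] bound the energy of the transform by [2 pi] times that of
    [u]. For [v] the indicator function of an interval, [e -> 0] recovers the
    integral of [u] over that interval, which therefore vanishes with the
    transform of [u]. *)

From HB Require Import structures.
Require Import Defs.
From mathcomp Require Import all_boot all_order all_algebra.
From mathcomp Require Import all_classical all_reals all_analysis.
From mathcomp Require Import measurable_realfun.
From mathcomp Require Import complex ring lra.

Set Implicit Arguments.
Unset Strict Implicit.
Unset Printing Implicit Defensive.

Import Order.TTheory GRing.Theory Num.Theory.
Import numFieldNormedType.Exports.
Import ComplexField.Normc.

Local Open Scope classical_set_scope.
Local Open Scope ring_scope.

(** * Affine change of variables *)

(** The weight [e^{-e|w|}] is chosen because its cosine transform and the mass of that transform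
    have elementary primitives: an exponential times trigonometric functions, and an arctangent. It
    also makes the double integrals absolutely convergent, since the transform of an integrable
    function need not be integrable.

    For a signal that is only in L^2, the transform is a limit over approximating sequences. This
    adds two tasks. For existence, completeness of L^2 is proved, and the bound makes the transforms
    of the truncations a Cauchy sequence. For injectivity, when the limit vanishes the transforms of
    the truncations are merely small in energy, so the interval argument has to be an inequality
    with a free parameter.

    The resolutions are extended reals, and [fourier] is determined only up to a null set. The
    scaling laws are therefore proved for integrals that may be infinite or of the form [+oo - +oo],
    and reach the dilated transform through equality almost everywhere. *)

(** Distributivity survives [+oo - +oo], whose value here is [-oo] and is preserved by a positive
    factor. This lets integrals of functions of both signs be scaled without integrability. *)
Lemma gt0_muleBr (R : realType) (c : R) (x y : \bar R) : 0 < c -> (0 <= x)%E -> (0 <= y)%E ->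
  (c%:E * x - c%:E * y = c%:E * (x - y))%E.
Proof.
move=> c0; have ce : (0 < c%:E)%E by rewrite lte_fin.
case: x => [x| |]//; case: y => [y| |]// _ _.
- by change ((c * x - c * y)%:E = (c * (x - y))%:E); rewrite mulrBr.
- by rewrite gt0_muley// addeNy// gt0_muleNy.
- by rewrite gt0_muley// addye// gt0_muley.
- by rewrite gt0_muley// addeNy// gt0_muleNy.
Qed.

Section change_of_variables.
Context {R : realType}.
Local Notation mu := (@lebesgue_measure R).

Let affine (a b : R) : measurableTypeR R -> measurableTypeR R :=
  fun x => a * x + b.

Let measurable_affine a b : measurable_fun setT (affine a b).
Proof.
by apply: measurable_funD => //; apply: measurable_funM => //; exact: measurable_id.
Qed.

(** Uniqueness of Lebesgue measure: [a] times the pushforward along the affine map gives every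
    half-open interval its length. *)
Lemma lebesgue_measure_affine (a b : R) (A : set R) : 0 < a -> measurable A ->
  (a%:E * mu ((fun x : R => a * x + b)%R @^-1` A) = mu A)%E.
Proof.
move=> a0 mA.
suff H (m : {measure set (measurableTypeR R) -> \bar R}) :
    (forall B, m B = a%:E * mu (affine a b @^-1` B))%E -> m A = mu A.
  exact: (H (mscale (NngNum (ltW a0)) (pushforward mu (affine a b)))).
move=> mE; apply/esym.
apply: (lebesgue_measure_unique (mu := m)) => // _ [[x y]] _ <-.
rewrite mE.
have -> : affine a b @^-1` `]x, y]%classic = `](x - b) / a, (y - b) / a]%classic.
  apply/seteqP; split => z /=; rewrite !in_itv/= /affine.
    by rewrite ltr_pdivrMr// ler_pdivlMr// ltrBlDr lerBrDr mulrC.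
  by rewrite ltr_pdivrMr// ler_pdivlMr// ltrBlDr lerBrDr mulrC.
rewrite !lebesgue_measure_itv/= !lte_fin ltr_pM2r ?invr_gt0// ltrD2r.
case: ifP => _; last by rewrite mule0.
by rewrite -!EFinB -EFinM; congr EFin; field; rewrite gt_eqF.
Qed.

Lemma ge0_integral_affine (a b : R) (f : R -> \bar R) : 0 < a ->
  measurable_fun setT f -> (forall x, 0 <= f x)%E ->
  (\int[mu]_x f (a * x + b)%R = a^-1%:E * \int[mu]_x f x)%E.
Proof.
move=> a0 mf f0.
rewrite [X in (_ = _ * X)%E](eq_measure_integral
  (mscale (NngNum (ltW a0)) (pushforward mu (affine a b)))); last first.
  by move=> A mA _; apply/esym; exact: lebesgue_measure_affine.
rewrite ge0_integral_mscale// muleA -EFinM mulVf ?gt_eqF// mul1e.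
by rewrite ge0_integral_pushforward.
Qed.

(** The positive and the negative part scale separately, and [gt0_muleBr] recombines them whatever
    their integrals are. First moments, whose integrand changes sign, depend on this generality. *)
Lemma integral_scale (a : R) (f : R -> \bar R) : 0 < a ->
  measurable_fun setT f ->
  (\int[mu]_x f (a * x)%R = a^-1%:E * \int[mu]_x f x)%E.
Proof.
move=> a0 mf; rewrite integralE [in RHS]integralE.
have ap := ge0_integral_affine 0 a0 (measurable_funepos mf) (funepos_ge0 f).
have an := ge0_integral_affine 0 a0 (measurable_funeneg mf) (funeneg_ge0 f).
have -> : (\int[mu]_x (fun x => f (a * x)%R)^\+ x = \int[mu]_x f^\+ (a * x + 0)%R)%E.
  by apply: eq_integral => x _; rewrite ?funeposE ?funenegE addr0.
have -> : (\int[mu]_x (fun x => f (a * x)%R)^\- x = \int[mu]_x f^\- (a * x + 0)%R)%E.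
  by apply: eq_integral => x _; rewrite ?funeposE ?funenegE addr0.
rewrite ap an.
rewrite gt0_muleBr ?invr_gt0//; apply: integral_ge0 => x _.
  exact: funepos_ge0.
exact: funeneg_ge0.
Qed.

Lemma Rintegral_scale (a : R) (f : R -> R) : 0 < a ->
  measurable_fun setT f ->
  \int[mu]_x f (a * x) = a^-1 * \int[mu]_x f x.
Proof.
move=> a0 mf; rewrite /Rintegral (integral_scale a0 (f := EFin \o f)); last exact/measurable_EFinP.
(* An infinite integral stays infinite after multiplication by [a^-1], and [fine] sends both sides
   to [0]. *)
move: (\int[mu]_x _)%E => [x| |] //=.
  by rewrite gt0_muley ?lte_fin ?invr_gt0//= mulr0.
by rewrite gt0_muleNy ?lte_fin ?invr_gt0//= mulr0.
Qed.

Lemma ge0_integral_reflect (b : R) (f : R -> \bar R) :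
  measurable_fun setT f -> (forall x, 0 <= f x)%E ->
  (\int[mu]_x f (b - x)%R = \int[mu]_x f x)%E.
Proof.
move=> mf f0.
have mg : measurable_fun setT (fun x : R => f (- x + b)%R).
  apply: measurableT_comp => //; apply: measurable_funD => //.
transitivity (\int[mu]_x f (- x + b)%R)%E; first by apply: eq_integral => x _; rewrite addrC.
transitivity (\int[pushforward mu (-%R : _ -> measurableTypeR R)]_x f (x + b)%R)%E.
  rewrite ge0_integral_pushforward//.
  apply: measurableT_comp => //; apply: measurable_funD => //.
rewrite (eq_measure_integral mu); last first.
  by move=> A mA _; exact: lebesgue_measureN.
have := @ge0_integral_affine 1 b f ltr01 mf f0.
rewrite invr1 mul1e => <-; apply: eq_integral => x _; by rewrite mul1r.
Qed.

End change_of_variables.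

(** * The Abel kernel and its cosine transform *)

Section abel_kernel.
Context {R : realType}.
Local Notation mu := (@lebesgue_measure R).

Definition abel (e w : R) : R := expR (- (e * `|w|)).

(** This is [2 * pi] times the Poisson kernel of the upper half-plane at height [e], in other words
    the Fourier transform of [abel e]. *)
Definition poisson (e x : R) : R := 2 * e / (e ^+ 2 + x ^+ 2).

Lemma abel_ge0 (e w : R) : 0 <= abel e w. Proof. exact: expR_ge0. Qed.

Lemma abel_le1 (e w : R) : 0 <= e -> abel e w <= 1.
Proof. by move=> e0; rewrite -expR0 ler_expR oppr_le0 mulr_ge0. Qed.

Lemma continuous_abel (e : R) : continuous (abel e).
Proof.
move=> x; apply: continuous_comp; last exact: continuous_expR.
apply: continuousN; apply: continuousM; first exact: cvg_cst.
exact: norm_continuous.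
Qed.

Lemma measurable_abel (e : R) : measurable_fun setT (abel e).
Proof. by apply: continuous_measurable_fun; exact: continuous_abel. Qed.

Lemma continuous_cosM (x : R) : continuous (fun w : R => cos (w * x)).
Proof.
move=> w; apply: continuous_comp; last exact: continuous_cos.
by apply: continuousM; [exact: cvg_id|exact: cvg_cst].
Qed.

Lemma continuous_sinM (x : R) : continuous (fun w : R => sin (w * x)).
Proof.
move=> w; apply: continuous_comp; last exact: continuous_sin.
by apply: continuousM; [exact: cvg_id|exact: cvg_cst].
Qed.

Let cvgMy (c : R) : 0 < c -> w * c @[w --> +oo] --> +oo.
Proof. by move=> c0; apply: (@gt0_cvgMly _ _ _ c id c0) => A. Qed.

Let sqrD_neq0 (e x : R) : 0 < e -> e ^+ 2 + x ^+ 2 != 0.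
Proof. by move=> e0; rewrite gt_eqF// ltr_wpDr ?sqr_ge0// exprn_gt0. Qed.

Lemma poisson_ge0 (e x : R) : 0 < e -> 0 <= poisson e x.
Proof.
by move=> e0; rewrite divr_ge0 ?addr_ge0 ?sqr_ge0// mulr_ge0// ltW.
Qed.

Lemma continuous_poisson (e : R) : 0 < e -> continuous (poisson e).
Proof.
move=> e0 x; apply: cvgM; first exact: cvg_cst.
apply: cvgV; first exact: sqrD_neq0.
apply: cvgD; first exact: cvg_cst.
exact: exprn_continuous.
Qed.

Lemma poissonN (e x : R) : poisson e (- x) = poisson e x.
Proof. by rewrite /poisson sqrrN. Qed.

(* The factor [1 + cos] keeps the integrand nonnegative, so that the improper
   fundamental theorem of calculus applies. *)
Let integral_abel_onePcos (e x : R) : 0 < e ->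
  (\int[mu]_w (abel e w * (1 + cos (w * x)))%:E = (2 / e + poisson e x)%:E)%E.
Proof.
move=> e0.
have s0 := sqrD_neq0 x e0.
have ne0 : e != 0 by rewrite gt_eqF.
pose f (w : R) := abel e w * (1 + cos (w * x)).
have f0 w : 0 <= f w.
  by rewrite mulr_ge0 ?abel_ge0// -lerBlDl sub0r cos_geN1.
have cf : continuous f.
  move=> w; apply: continuousM; first exact: continuous_abel.
  by apply: continuousD; [exact: cvg_cst|exact: continuous_cosM].
rewrite (@ge0_symfun_integralT _ f)//; last first.
  by move=> w; rewrite /f /abel/= normrN mulNr cosN.
rewrite -set_itvcy.
(* The real part of [exp((-e + i x) w) / (-e + i x)], plus a primitive of [expR (- (e * w))]. The
   constant [C] below bounds the second factor uniformly in [w], so that [F] vanishes at [+oo]. *)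
pose F (w : R) := expR (- (e * w)) *
  ((x * sin (w * x) - e * cos (w * x)) / (e ^+ 2 + x ^+ 2) - e^-1).
have dF (w : R) : is_derive w 1 F (expR (- (e * w)) * (1 + cos (w * x))).
  rewrite /F; apply: is_derive_eq.
  rewrite !scaler0 !(addr0, add0r) /GRing.scale/=.
  by field; rewrite ne0 s0.
pose C := (`|x| + e) / (e ^+ 2 + x ^+ 2) + e^-1.
have FC w : `|(x * sin (w * x) - e * cos (w * x)) / (e ^+ 2 + x ^+ 2) - e^-1| <= C.
  rewrite (le_trans (ler_normB _ _))// /C normfV (gtr0_norm e0) lerD2r.
  rewrite normrM normfV (@ger0_norm _ (e ^+ 2 + x ^+ 2)) ?addr_ge0 ?sqr_ge0//.
  rewrite ler_wpM2r ?invr_ge0 ?addr_ge0 ?sqr_ge0//.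
  rewrite (le_trans (ler_normB _ _))// lerD// normrM.
    by rewrite ler_piMr ?sin_max.
  by rewrite (gtr0_norm e0) ler_piMr ?cos_max// ltW.
have eC : expR (- (e * w)) * C @[w --> +oo] --> 0.
  rewrite -(mul0r C); apply: cvgM; last exact: cvg_cst.
  apply: (@cvg_comp _ _ _ (fun w => e * w) (fun w => expR (- w)) _ (pinfty_nbhs R)).
    under eq_fun do rewrite mulrC.
    exact: cvgMy.
  exact: cvgr_expR.
rewrite (@ge0_continuous_FTC2y _ f F _ 0)//.
- rewrite -EFinB -EFinM; congr EFin.
  rewrite /F mulr0 mul0r oppr0 expR0 sin0 cos0 /poisson.
  by field; rewrite ne0 s0.
- exact: continuous_subspaceT.
- apply: (@squeeze_cvgr _ _ _ _ (fun w => - (expR (- (e * w)) * C))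
    (fun w => expR (- (e * w)) * C)).
  + apply: nearW => w; rewrite -ler_norml normrM ger0_norm ?expR_ge0//.
    by rewrite ler_wpM2l ?expR_ge0.
  + by rewrite -[X in _ --> X]oppr0; apply: cvgN.
  + exact: eC.

- apply: cvg_at_right_filter.
  have [/derivable1_diffP/differentiable_continuous+ _] := dF 0.
  exact.
- move=> w; rewrite in_itv/= andbT => w0.
  by rewrite derive1E derive_val /f /abel gtr0_norm.
Qed.

(** The case [x = 0] of the identity above: the factor [1 + cos] is then [2], and both terms on the
    right are [2 / e]. *)
Lemma integral_abel (e : R) : 0 < e -> (\int[mu]_w (abel e w)%:E = (2 / e)%:E)%E.
Proof.
move=> e0; have := integral_abel_onePcos 0 e0.
under eq_integral do rewrite mulr0 cos0 mulrC EFinM.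
rewrite ge0_integralZl_EFin//; last 2 first.
- by move=> w _; rewrite lee_fin abel_ge0.
- by apply/measurable_EFinP; exact: measurable_abel.
have -> : (2 / e + poisson e 0)%:E = (2%:E * (2 / e)%:E)%E.
  by rewrite -EFinM; congr EFin; rewrite /poisson; field; rewrite gt_eqF.
move: (integral _ _ _) => [r| |].
- by rewrite -!EFinM => -[h]; congr EFin; lra.
- by rewrite gt0_muley// lte_fin.
- by rewrite gt0_muleNy// lte_fin.
Qed.

Lemma integrable_abel (e : R) : 0 < e -> mu.-integrable setT (EFin \o abel e).
Proof.
move=> e0; apply/integrableP; split.
  by apply/measurable_EFinP; exact: measurable_abel.
under eq_integral do rewrite /= ger0_norm ?abel_ge0//.
by rewrite integral_abel// ltry.
Qed.

(** Subtracting [integral_abel] removes the [1] of [1 + cos]; this is legitimate now that [abel e]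
    is known to be integrable. *)
Lemma Rintegral_abel_cos (e x : R) : 0 < e ->
  \int[mu]_w (abel e w * cos (w * x)) = poisson e x.
Proof.
move=> e0; have := integral_abel_onePcos x e0.
under eq_integral do rewrite mulrDr mulr1 EFinD.
have ic : mu.-integrable setT (EFin \o (fun w => abel e w * cos (w * x))).
  apply: le_integrable (integrable_abel e0) => //.
    apply/measurable_EFinP/measurable_funM; first exact: measurable_abel.
    by apply: continuous_measurable_fun; exact: continuous_cosM.
  by move=> w _ /=; rewrite lee_fin normrM ler_piMr ?cos_max.
rewrite integralD//; last exact: integrable_abel.
rewrite integral_abel// /Rintegral.
have /fineK <- := integrable_fin_num measurableT ic.
by rewrite -EFinD => -[] /addrI <-.
Qed.

(** The primitive [2 * atan (x / e)] vanishes at [0] and tends to [pi] at [+oo]; evenness of the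
    kernel doubles this. *)
Lemma integral_poisson (e s : R) : 0 < e ->
  (\int[mu]_t (poisson e (s - t))%:E = (2 * pi)%:E)%E.
Proof.
move=> e0.
have ne0 : e != 0 by rewrite gt_eqF.
have cp := continuous_poisson e0.
rewrite (ge0_integral_reflect s (f := fun t => (poisson e t)%:E)); last 2 first.
- by apply/measurable_EFinP; exact: continuous_measurable_fun.
- by move=> x; rewrite lee_fin poisson_ge0.
rewrite (@ge0_symfun_integralT _ (poisson e))//; last 2 first.
- by move=> x; exact: poisson_ge0.
- by move=> x /=; rewrite poissonN.
rewrite -set_itvcy.
pose F (x : R) := 2 * atan (x * e^-1).
have dF (x : R) : is_derive x 1 F (poisson e x).
  have h : is_derive x 1 (atan \o (fun x => x * e^-1)) ((1 + (x / e) ^+ 2)^-1 * e^-1).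
    apply: is_derive1_comp; apply: is_derive_eq.
    by rewrite scaler0 add0r /GRing.scale/= mulr1.
  rewrite (_ : F = 2 \*: (atan \o (fun x => x * e^-1))) //.
  apply: is_derive_eq; rewrite /GRing.scale/= /poisson.
  by field; rewrite sqrD_neq0// ne0.
rewrite (@ge0_continuous_FTC2y _ (poisson e) F _ pi)//.
- by rewrite -EFinB -EFinM /F mul0r atan0 mulr0 subr0.
- by move=> x _; exact: poisson_ge0.
- exact: continuous_subspaceT.
- rewrite [X in _ --> X](_ : _ = 2 * (pi / 2)); last by field.
  apply: cvgM; first exact: cvg_cst.
  apply: (@cvg_comp _ _ _ (fun w => w * e^-1) atan _ (pinfty_nbhs R)); last exact: cvgy_atan.
  by apply: cvgMy; rewrite invr_gt0.
- apply: cvg_at_right_filter.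
  have [/derivable1_diffP/differentiable_continuous+ _] := dF 0.
  exact.
- by move=> w _; rewrite derive1E derive_val.
Qed.

(** This closed form shows the approximate identity at work: as [e] tends to [0] it tends to
    [2 * pi] for [s] inside the interval and to [0] outside. *)
Lemma integral_poisson_itv (e s a b : R) : 0 < e -> a < b ->
  (\int[mu]_(t in `[a, b]) (poisson e (s - t))%:E =
   (2 * (atan ((b - s) / e) - atan ((a - s) / e)))%:E)%E.
Proof.
move=> e0 ab.
have ne0 : e != 0 by rewrite gt_eqF.
pose F (x : R) := 2 * atan ((x - s) * e^-1).
have dF (x : R) : is_derive x 1 F (poisson e (s - x)).
  have h : is_derive x 1 (atan \o (fun x => (x - s) * e^-1)) ((1 + ((x - s) / e) ^+ 2)^-1 * e^-1).
    apply: is_derive1_comp; apply: is_derive_eq.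
    by rewrite scaler0 add0r /GRing.scale/= subr0 mulr1.
  rewrite (_ : F = 2 \*: (atan \o (fun x => (x - s) * e^-1))) //.
  apply: is_derive_eq; rewrite /GRing.scale/= /poisson.
  field; rewrite ne0 sqrD_neq0//=.
have cp : continuous (fun t : R => poisson e (s - t)).
  move=> x; apply: (@continuous_comp _ _ _ (fun t : R => s - t) (poisson e)).
    by apply: continuousB; [exact: cvg_cst|exact: cvg_id].
  exact: continuous_poisson.
have cF x : F t @[t --> x] --> F x.
  have [/derivable1_diffP/differentiable_continuous+ _] := dF x.
  exact.
rewrite (@continuous_FTC2 _ _ F)//.
- by rewrite -EFinB /F -mulrBr.
- exact: continuous_subspaceT.
- split; first by move=> x _; exact: ex_derive.
    exact: cvg_at_right_filter.
  exact: cvg_at_left_filter.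
- by move=> w _; rewrite derive1E derive_val.
Qed.

End abel_kernel.

(** * Fubini's theorem for dominated functions *)

Section dominated_fubini.
Context d1 d2 (T1 : measurableType d1) (T2 : measurableType d2) (R : realType).
Variables (m1 : {sigma_finite_measure set T1 -> \bar R})
  (m2 : {sigma_finite_measure set T2 -> \bar R}).
Variables (f : T1 * T2 -> R) (g : T1 -> R) (h : T2 -> R).
Hypotheses (mf : measurable_fun setT f)
  (ig : m1.-integrable setT (EFin \o g)) (ih : m2.-integrable setT (EFin \o h))
  (fgh : forall x y, `|f (x, y)| <= g x * h y).

(** Tonelli's theorem applied to the majorant, whose iterated integral is the product of the finite
    integrals of [|g|] and [|h|]. *)
Let integrable_prod : (m1 \x m2)%E.-integrable setT (EFin \o f).
Proof.
have mF : measurable_fun setT (EFin \o f) by exact/measurable_EFinP.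
apply: (integrable12ltyP m1 m2 mF).2 => /=.
have mh : measurable_fun setT (fun y => `|(h y)%:E|%E).
  by apply: measurableT_comp => //; exact: (measurable_int m2).
have mg : measurable_fun setT (fun y => `|(g y)%:E|%E).
  by apply: measurableT_comp => //; exact: (measurable_int m1).
have h0 : (0 <= \int[m2]_y `|(h y)%:E|)%E by exact: integral_ge0.
apply: (@le_lt_trans _ _ (\int[m1]_x (`|(g x)%:E| * \int[m2]_y `|(h y)%:E|))%E).
  apply: ge0_le_integral => //.
  - by move=> x _; exact: integral_ge0.
  - apply: (@measurable_fun_fubini_tonelli_F _ _ _ _ _ _ (abse \o (EFin \o f))) => //=.
    exact: measurableT_comp.
  - by apply: emeasurable_funM.
  - move=> x _; rewrite -ge0_integralZl//.
    apply: ge0_le_integral => //.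
    + apply/measurable_EFinP; apply: measurableT_comp => //.
      apply: (measurableT_comp mf).
      exact: pair1_measurable.
    + exact: measurable_funeM.
    + move=> y _; rewrite -abseM -EFinM /= lee_fin (le_trans (fgh x y))//.
      exact: ler_norm.
rewrite ge0_integralZr// lte_mul_pinfty//.
- exact: integral_ge0.
- rewrite ge0_fin_numE; last exact: integral_ge0.
  by case/integrableP : ig.
- by case/integrableP : ih.
Qed.

Let integrable_section1 x : m2.-integrable setT (EFin \o (fun y => f (x, y))).
Proof.
apply: (@le_integrable _ _ _ _ _ _ _ (fun y => (g x)%:E * (h y)%:E)%E) => //.
- apply/measurable_EFinP; apply: (measurableT_comp mf).
  exact: pair1_measurable.
- move=> y _; rewrite -EFinM lee_fin (le_trans (fgh x y))//.
  exact: ler_norm.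
- exact: integrableZl.
Qed.

Let integrable_section2 y : m1.-integrable setT (EFin \o (fun x => f (x, y))).
Proof.
apply: (@le_integrable _ _ _ _ _ _ _ (fun x => (h y)%:E * (g x)%:E)%E) => //.
- apply/measurable_EFinP; apply: (measurableT_comp mf).
  exact: pair2_measurable.
- move=> x _; rewrite -EFinM lee_fin (le_trans (fgh x y))// mulrC.
  exact: ler_norm.
- exact: integrableZl.
Qed.

Lemma integrable_dominated_section :
  m1.-integrable setT (EFin \o (fun x => \int[m2]_y f (x, y))).
Proof.
have := integrable_fubini_F integrable_prod.
apply: eq_integrable => // x _ /=.
rewrite /fubini_F /Rintegral fineK//.
exact: (integrable_fin_num measurableT (integrable_section1 x)).
Qed.

(** The product form of the majorant makes every section integrable, not just almost every one. Each
    inner real integral is thus the true value of the extended one, and Fubini's theorem transfers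
    to real integrals. *)
Lemma dominated_fubini :
  \int[m1]_x (\int[m2]_y f (x, y)) = \int[m2]_y (\int[m1]_x f (x, y)).
Proof.
rewrite /Rintegral; congr fine.
transitivity (\int[m1]_x \int[m2]_y (f (x, y))%:E)%E.
  apply: eq_integral => x _; rewrite fineK//.
  exact: (integrable_fin_num measurableT (integrable_section1 x)).
rewrite (Fubini integrable_prod).
apply: eq_integral => y _; rewrite fineK//.
  exact: (integrable_fin_num measurableT (integrable_section2 y)).
Qed.

End dominated_fubini.

(** * Cosine and sine transforms *)

Section trigonometric_transforms.
Context {R : realType}.
Local Notation mu := (@lebesgue_measure R).
Implicit Types (u v h : R -> R).

Lemma integrable_mul_le1 u h : mu.-integrable setT (EFin \o u) ->
  measurable_fun setT h -> (forall t, `|h t| <= 1) ->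
  mu.-integrable setT (EFin \o (fun t => u t * h t)).
Proof.
move=> iu mh h1; apply: le_integrable (iu) => //.
  apply/measurable_EFinP/measurable_funM => //.
  by apply/measurable_EFinP; exact: measurable_int iu.
by move=> t _ /=; rewrite lee_fin normrM ler_piMr.
Qed.

Lemma measurable_integrable u : mu.-integrable setT (EFin \o u) ->
  measurable_fun setT u.
Proof. by move=> iu; apply/measurable_EFinP; exact: measurable_int iu. Qed.

Definition cos_transform u (w : R) : R := \int[mu]_t (u t * cos (w * t)).

Definition sin_transform u (w : R) : R := \int[mu]_t (u t * sin (w * t)).

Lemma measurable_cosMl (w : R) : measurable_fun setT (fun t : R => cos (w * t)).
Proof.
apply: continuous_measurable_fun => t.
by under eq_fun do rewrite mulrC; exact: continuous_cosM.
Qed.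

Lemma measurable_sinMl (w : R) : measurable_fun setT (fun t : R => sin (w * t)).
Proof.
apply: continuous_measurable_fun => t.
by under eq_fun do rewrite mulrC; exact: continuous_sinM.
Qed.

Lemma integrable_mul_cos u w : mu.-integrable setT (EFin \o u) ->
  mu.-integrable setT (EFin \o (fun t => u t * cos (w * t))).
Proof.
move=> iu; apply: integrable_mul_le1 => //; first exact: measurable_cosMl.
by move=> t; exact: cos_max.
Qed.

Lemma integrable_mul_sin u w : mu.-integrable setT (EFin \o u) ->
  mu.-integrable setT (EFin \o (fun t => u t * sin (w * t))).
Proof.
move=> iu; apply: integrable_mul_le1 => //; first exact: measurable_sinMl.
by move=> t; exact: sin_max.
Qed.

(** Continuity under the integral sign with majorant [|u|], for cosine and sine at once. Its main
    use is measurability of the transforms in [w]. *)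
Let continuous_transform h u : continuous h -> (forall x, `|h x| <= 1) ->
  mu.-integrable setT (EFin \o u) ->
  continuous (fun w : R => \int[mu]_t (u t * h (w * t))).
Proof.
move=> ch h1 iu w.
have mh (x : R) : measurable_fun setT (fun t : R => h (x * t)).
  apply: continuous_measurable_fun => t.
  apply: (@continuous_comp _ _ _ (fun t : R => x * t) h); last exact: ch.
  by apply: continuousM; [exact: cvg_cst|exact: cvg_id].
apply: (@continuity_under_integral R _ _ mu (fun w t => u t * h (w * t)) setT
  measurableT (w - 1) (w + 1) _ _ (fun t => `|u t|)).
- by move=> x _; apply: integrable_mul_le1.
- apply: aeW => t _ x _.
  apply: continuousM; first exact: cvg_cst.
  apply: (@continuous_comp _ _ _ (fun x : R => x * t) h); last exact: ch.
  by apply: continuousM; [exact: cvg_id|exact: cvg_cst].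
- exact: integrable_norm.
- by move=> x _; apply: aeW => t _; rewrite normrM ler_piMr.
- by rewrite inE/= in_itv/= ltrBlDr ltrDl ltr01.
Qed.

Lemma continuous_cos_transform u : mu.-integrable setT (EFin \o u) ->
  continuous (cos_transform u).
Proof. by apply: continuous_transform; [exact: continuous_cos|exact: cos_max]. Qed.

Lemma continuous_sin_transform u : mu.-integrable setT (EFin \o u) ->
  continuous (sin_transform u).
Proof. by apply: continuous_transform; [exact: continuous_sin|exact: sin_max]. Qed.

Let transform_le h u (w : R) : measurable_fun setT (fun t => h (w * t)) ->
  (forall x, `|h x| <= 1) -> mu.-integrable setT (EFin \o u) ->
  `|\int[mu]_t (u t * h (w * t))| <= \int[mu]_t `|u t|.
Proof.
move=> mh h1 iu.
have iuh : mu.-integrable setT (EFin \o (fun t => u t * h (w * t))).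
  exact: integrable_mul_le1.
apply: (le_trans (le_normr_Rintegral _ iuh)) => //.
apply: le_Rintegral => //; [exact: integrable_norm|exact: integrable_norm|].
by move=> t _; rewrite normrM ler_piMr.
Qed.

Lemma cos_transform_le u w : mu.-integrable setT (EFin \o u) ->
  `|cos_transform u w| <= \int[mu]_t `|u t|.
Proof.
by move=> iu; apply: transform_le => //; [exact: measurable_cosMl|exact: cos_max].
Qed.

Lemma sin_transform_le u w : mu.-integrable setT (EFin \o u) ->
  `|sin_transform u w| <= \int[mu]_t `|u t|.
Proof.
by move=> iu; apply: transform_le => //; [exact: measurable_sinMl|exact: sin_max].
Qed.

End trigonometric_transforms.

(** * The regularized Parseval identity *)

Section abel_parseval.
Context {R : realType}.
Local Notation mu := (@lebesgue_measure R).
Variables (u v : R -> R) (e : R).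
Hypotheses (e0 : 0 < e).
Hypotheses (iu : mu.-integrable setT (EFin \o u))
  (iv : mu.-integrable setT (EFin \o v)).

Let Cv := cos_transform v.
Let Sv := sin_transform v.
(** The real part of [e^{j w s} V(w)], where [V = Cv - j Sv] is the transform of [v], damped by
    [abel e]: the integrand of a regularized inversion formula. *)
Let inner (s w : R) := abel e w * (cos (w * s) * Cv w + sin (w * s) * Sv w).

Let mu_ : measurable_fun (@setT (measurableTypeR R)) u.
Proof. exact: measurable_integrable. Qed.

Let mv : measurable_fun (@setT (measurableTypeR R)) v.
Proof. exact: measurable_integrable. Qed.

Let mC : measurable_fun (@setT (measurableTypeR R)) Cv.
Proof. by apply: continuous_measurable_fun; exact: continuous_cos_transform. Qed.

Let mS : measurable_fun (@setT (measurableTypeR R)) Sv.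
Proof. by apply: continuous_measurable_fun; exact: continuous_sin_transform. Qed.

Let ma : measurable_fun (@setT (measurableTypeR R)) (abel e).
Proof. exact: measurable_abel. Qed.

Let mcos d (T : measurableType d) (f : T -> R) :
  measurable_fun setT f -> measurable_fun setT (fun x => cos (f x)).
Proof.
move=> mf; apply: (measurableT_comp (f := (@cos R))) => //.
by apply: continuous_measurable_fun; exact: continuous_cos.
Qed.

Let msin d (T : measurableType d) (f : T -> R) :
  measurable_fun setT f -> measurable_fun setT (fun x => sin (f x)).
Proof.
move=> mf; apply: (measurableT_comp (f := (@sin R))) => //.
by apply: continuous_measurable_fun; exact: continuous_sin.
Qed.

Let m1 : measurable_fun setT
  (fun z : measurableTypeR R * measurableTypeR R => z.1 : R).
Proof. exact: measurable_fst. Qed.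

Let m2 : measurable_fun setT
  (fun z : measurableTypeR R * measurableTypeR R => z.2 : R).
Proof. exact: measurable_snd. Qed.

(** Regularized Fourier inversion. The addition formula merges the two products into
    [cos (w * (s - t))]; after exchanging [w] and [t], the integral over [w] is the Poisson kernel.
    Domination by [abel e w * |v t|] justifies the exchange. *)
Let innerE s : \int[mu]_w inner s w = \int[mu]_t (v t * poisson e (s - t)).
Proof.
pose f (z : measurableTypeR R * measurableTypeR R) : R :=
  abel e z.1 * (v z.2 * cos (z.1 * (s - z.2))).
transitivity (\int[mu]_w \int[mu]_t f (w, t)).
  apply: eq_Rintegral => w _; rewrite /inner /f/=.
  have ic : mu.-integrable setT (EFin \o (fun t => cos (w * s) * (v t * cos (w * t)))).
    by have := integrableZl measurableT (cos (w * s)) (integrable_mul_cos w iv).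
  have is' : mu.-integrable setT (EFin \o (fun t => sin (w * s) * (v t * sin (w * t)))).
    by have := integrableZl measurableT (sin (w * s)) (integrable_mul_sin w iv).
  rewrite [RHS]RintegralZl//; last first.
    have := integrableD measurableT ic is'.
    apply: eq_integrable => // t _ /=; rewrite -EFinD; congr EFin.
    by rewrite mulrBr cosB; ring.
  congr (_ * _).
  rewrite /Cv /cos_transform /Sv /sin_transform -!RintegralZl//.
  - rewrite -RintegralD//; apply: eq_Rintegral => t _.
    by rewrite mulrBr cosB; ring.
  - exact: integrable_mul_sin.
  - exact: integrable_mul_cos.
rewrite (@dominated_fubini _ _ _ _ _ mu mu f (abel e) (fun t => `|v t|)).
- apply: eq_Rintegral => t _; rewrite /f/= -(Rintegral_abel_cos (s - t) e0).
  rewrite -RintegralZl//; last first.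
    apply: integrable_mul_le1 => //; first exact: integrable_abel.
      by apply: mcos; apply: measurable_funM.
    by move=> w; exact: cos_max.
  by apply: eq_Rintegral => w _; rewrite mulrCA.
- apply: measurable_funM; first exact: (measurableT_comp ma).
  apply: measurable_funM; first exact: (measurableT_comp mv).
  by apply: mcos; apply: measurable_funM => //; apply: measurable_funB.
- exact: integrable_abel.
- exact: integrable_norm.
- move=> w t; rewrite /f/= normrM ger0_norm ?abel_ge0// ler_wpM2l ?abel_ge0//.
  by rewrite normrM ler_piMr ?cos_max.
Qed.

Let f (z : measurableTypeR R * measurableTypeR R) : R := u z.1 * inner z.1 z.2.

(** The factor [2] counts the cosine and the sine term of [inner], each bounded by the L^1 norm of
    [v]. *)
Let N := 2 * \int[mu]_t `|v t|.

Let inner_le s w : `|inner s w| <= N * abel e w.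
Proof.
rewrite /inner normrM ger0_norm ?abel_ge0// mulrC ler_wpM2r ?abel_ge0//.
rewrite (le_trans (ler_normD _ _))// /N mulr2n mulrDl mul1r lerD// normrM.
  by rewrite -[leRHS]mul1r ler_pM ?cos_max// cos_transform_le.
by rewrite -[leRHS]mul1r ler_pM ?sin_max// sin_transform_le.
Qed.

Let minner : measurable_fun setT (fun z : measurableTypeR R * measurableTypeR R =>
  inner z.1 z.2).
Proof.
apply: measurable_funM; first exact: (measurableT_comp ma).
apply: measurable_funD; apply: measurable_funM.
- by apply: mcos; apply: measurable_funM.
- exact: (measurableT_comp mC).
- by apply: msin; apply: measurable_funM.
- exact: (measurableT_comp mS).
Qed.

Let mf : measurable_fun setT f.
Proof. by apply: measurable_funM => //; exact: (measurableT_comp mu_). Qed.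

Let f_le s w : `|f (s, w)| <= `|u s| * (N * abel e w).
Proof. by rewrite /f normrM ler_wpM2l//; exact: inner_le. Qed.

Let ih : mu.-integrable setT (EFin \o (fun w => N * abel e w)).
Proof. by have := integrableZl measurableT N (integrable_abel e0). Qed.

Let iinner s : mu.-integrable setT (EFin \o inner s).
Proof.
apply: le_integrable ih => //.
  apply/measurable_EFinP.
  apply: (measurableT_comp minner (g := fun w => (s, w))).
  exact: pair1_measurable.
move=> w _ /=; rewrite lee_fin; apply: (le_trans (inner_le s w)).
exact: ler_norm.
Qed.

Let sectionE s : \int[mu]_w f (s, w) = u s * \int[mu]_t (v t * poisson e (s - t)).
Proof. by rewrite -innerE -RintegralZl//; exact: iinner. Qed.

Lemma integrable_abel_parseval :
  mu.-integrable setT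
    (EFin \o (fun s => u s * \int[mu]_t (v t * poisson e (s - t)))).
Proof.
have := @integrable_dominated_section _ _ _ _ _ mu mu f (fun s => `|u s|)
  (fun w => N * abel e w) mf (integrable_norm iu) ih f_le.
by apply: eq_integrable => // s _ /=; rewrite sectionE.
Qed.

(** Integrating the inversion formula against [u] and exchanging [s] with [w], under the majorant
    [|u s| * (N * abel e w)], turns [cos (w * s)] and [sin (w * s)] into the transforms of [u]. *)
Lemma abel_parseval :
  \int[mu]_w (abel e w * (cos_transform u w * cos_transform v w +
                          sin_transform u w * sin_transform v w)) =
  \int[mu]_s (u s * \int[mu]_t (v t * poisson e (s - t))).
Proof.
transitivity (\int[mu]_s \int[mu]_w f (s, w)); last first.
  by apply: eq_Rintegral => s _; rewrite sectionE.
rewrite (@dominated_fubini _ _ _ _ _ mu mu f (fun s => `|u s|)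
  (fun w => N * abel e w) mf (integrable_norm iu) ih f_le).
apply: eq_Rintegral => w _; rewrite /f /inner/= -/(Cv w) -/(Sv w).
have ic := integrable_mul_cos w iu.
have is' := integrable_mul_sin w iu.
transitivity (\int[mu]_x (abel e w * Cv w * (u x * cos (w * x)) +
                          abel e w * Sv w * (u x * sin (w * x)))); last first.
  by apply: eq_Rintegral => x _; ring.
rewrite RintegralD//.
- rewrite !RintegralZl// -/(cos_transform u w) -/(sin_transform u w); ring.
- by have := integrableZl measurableT (abel e w * Cv w) ic.
- by have := integrableZl measurableT (abel e w * Sv w) is'.
Qed.

End abel_parseval.

(** * Boundedness of the transforms in L^2 *)

Section transform_energy.
Context {R : realType}.
Local Notation mu := (@lebesgue_measure R).
Implicit Types (u v : R -> R).

(** The energy of the Fourier transform [C - j S] of a real [u]. *)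
Definition transform_energy u : \bar R :=
  (\int[mu]_w (cos_transform u w ^+ 2 + sin_transform u w ^+ 2)%:E)%E.

Lemma transform_energy_ge0 u : (0 <= transform_energy u)%E.
Proof. by apply: integral_ge0 => w _; rewrite lee_fin addr_ge0 ?sqr_ge0. Qed.

Lemma measurable_cos_transform u : mu.-integrable setT (EFin \o u) ->
  measurable_fun setT (cos_transform u).
Proof.
by move=> iu; apply: continuous_measurable_fun; exact: continuous_cos_transform.
Qed.

Lemma measurable_sin_transform u : mu.-integrable setT (EFin \o u) ->
  measurable_fun setT (sin_transform u).
Proof.
by move=> iu; apply: continuous_measurable_fun; exact: continuous_sin_transform.
Qed.

Lemma poisson_le (e x : R) : 0 < e -> poisson e x <= 2 / e.
Proof.
move=> e0; rewrite /poisson ler_pdivrMr; last first.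
  by rewrite ltr_wpDr ?sqr_ge0// exprn_gt0.
have -> : 2 * e = 2 / e * e ^+ 2 by field; rewrite gt_eqF.
by rewrite ler_wpM2l ?lerDl ?sqr_ge0// divr_ge0// ltW.
Qed.

Lemma measurable_poissonB (e s : R) : 0 < e ->
  measurable_fun setT (fun t : R => poisson e (s - t)).
Proof.
move=> e0; apply: (measurableT_comp (f := poisson e)).
  by apply: continuous_measurable_fun; exact: continuous_poisson.
exact: measurable_funB.
Qed.

Lemma integrable_mul_poisson u (e s : R) : 0 < e ->
  mu.-integrable setT (EFin \o u) ->
  mu.-integrable setT (EFin \o (fun t => u t * poisson e (s - t))).
Proof.
move=> e0 iu.
have := integrableZl measurableT (2 / e) iu.
apply: le_integrable => //.
  apply/measurable_EFinP/measurable_funM; first exact: measurable_integrable.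
  exact: measurable_poissonB.
move=> t _ /=; rewrite lee_fin (normrM (u t)) (normrM (2 / e)) mulrC ler_wpM2r//.
rewrite (ger0_norm (poisson_ge0 _ e0)) ger0_norm; last by rewrite divr_ge0// ltW.
exact: poisson_le.
Qed.

(* Schur test: [2 |u s| |u t| <= u s ^+ 2 + u t ^+ 2] and each marginal of the
   kernel has mass [2 * pi]. *)
Let poisson_form_le u (e : R) : 0 < e -> mu.-integrable setT (EFin \o u) ->
  ((\int[mu]_s (u s * \int[mu]_t (u t * poisson e (s - t))))%:E <=
   (2 * pi)%:E * \int[mu]_t (u t ^+ 2)%:E)%E.
Proof.
move=> e0 iu.
have mu_ : measurable_fun (@setT (measurableTypeR R)) u by exact: measurable_integrable.
have mu2 : measurable_fun (@setT (measurableTypeR R)) (fun t => (u t ^+ 2)%:E).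
  by apply/measurable_EFinP; exact: measurable_funX.
have pi20 : (0 <= (2 * pi : R)%:E)%E by rewrite lee_fin mulr_ge0// pi_ge0.
set X := (\int[mu]_t (u t ^+ 2)%:E)%E.
have X0 : (0 <= X)%E by apply: integral_ge0 => t _; rewrite lee_fin sqr_ge0.
have mK : measurable_fun setT (fun z : measurableTypeR R * measurableTypeR R =>
    poisson e (z.1 - z.2)).
  apply: (measurableT_comp (f := poisson e)).
    by apply: continuous_measurable_fun; exact: continuous_poisson.
  by apply: measurable_funB; [exact: measurable_fst|exact: measurable_snd].
pose A (z : measurableTypeR R * measurableTypeR R) : \bar R :=
  (2^-1 * (u z.1 ^+ 2 * poisson e (z.1 - z.2)))%:E.
pose B (z : measurableTypeR R * measurableTypeR R) : \bar R :=
  (2^-1 * (u z.2 ^+ 2 * poisson e (z.1 - z.2)))%:E.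
have mA : measurable_fun setT A.
  apply/measurable_EFinP; apply: measurable_funM => //.
  apply: measurable_funM => //; apply: measurable_funX.
  exact: (measurableT_comp mu_ measurable_fst).
have mB : measurable_fun setT B.
  apply/measurable_EFinP; apply: measurable_funM => //.
  apply: measurable_funM => //; apply: measurable_funX.
  exact: (measurableT_comp mu_ measurable_snd).
have A0 z : (0 <= A z)%E.
  by rewrite lee_fin mulr_ge0 ?invr_ge0// mulr_ge0 ?sqr_ge0 ?poisson_ge0.
have B0 z : (0 <= B z)%E.
  by rewrite lee_fin mulr_ge0 ?invr_ge0// mulr_ge0 ?sqr_ge0 ?poisson_ge0.
have mA2 s : measurable_fun setT (fun t : measurableTypeR R => A (s, t)).
  by apply: (measurableT_comp mA); exact: pair1_measurable.
have mB2 s : measurable_fun setT (fun t : measurableTypeR R => B (s, t)).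
  by apply: (measurableT_comp mB); exact: pair1_measurable.
have half (f : R -> \bar R) : (forall s, f s = (pi * u s ^+ 2)%:E) ->
    (\int[mu]_s f s = pi%:E * X)%E.
  move=> fE; rewrite -ge0_integralZl//; last 2 first.
  - by move=> t _; rewrite lee_fin sqr_ge0.
  - by rewrite lee_fin pi_ge0.
  by apply: eq_integral => s _; rewrite fE.
have inner s (c : R) : 0 <= c ->
    (\int[mu]_t (2^-1 * (c * poisson e (s - t)))%:E = (pi * c)%:E)%E.
  move=> c0; under eq_integral do rewrite mulrA EFinM.
  rewrite ge0_integralZl//.
  - by rewrite integral_poisson// -EFinM; congr EFin; field.
  - by apply/measurable_EFinP; exact: measurable_poissonB.
  - by move=> t _; rewrite lee_fin poisson_ge0.
  - by rewrite lee_fin mulr_ge0// invr_ge0.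
have IA : (\int[mu]_s \int[mu]_t A (s, t) = pi%:E * X)%E.
  by apply: half => s; rewrite -(inner s (u s ^+ 2)) ?sqr_ge0.
(* Here the square depends on the inner variable, so Tonelli's theorem comes first; evenness of the
   kernel then reduces the case to the one of [A]. *)
have IB : (\int[mu]_s \int[mu]_t B (s, t) = pi%:E * X)%E.
  rewrite (fubini_tonelli (m1 := mu) (m2 := mu) B)//.
  apply: half => t; rewrite -(inner t (u t ^+ 2)) ?sqr_ge0//.
  by apply: eq_integral => s _; rewrite /B/= -poissonN opprB.
have -> : ((2 * pi)%:E * X = \int[mu]_s \int[mu]_t (A (s, t) + B (s, t)))%E.
  transitivity (pi%:E * X + pi%:E * X)%E.
    rewrite -ge0_muleDl ?lee_fin ?pi_ge0// -EFinD; congr (_%:E * _)%E.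
    by rewrite mulr2n mulrDl mul1r.
  rewrite -{1}IA -IB -ge0_integralD//.
  - by apply: eq_integral => s _; rewrite -ge0_integralD.
  - by move=> s _; exact: integral_ge0.
  - exact: (measurable_fun_fubini_tonelli_F A).
  - by move=> s _; exact: integral_ge0.
  - exact: (measurable_fun_fubini_tonelli_F B).
have ip := integrable_abel_parseval e0 iu iu.
apply: (@le_trans _ _ (\int[mu]_s `|u s * \int[mu]_t (u t * poisson e (s - t))|%:E)%E).
  have /fineK <- := integrable_fin_num measurableT (integrable_norm ip).
  rewrite lee_fin (le_trans (ler_norm _))//.
  exact: (le_normr_Rintegral measurableT ip).
apply: ge0_le_integral => //.
- by apply/measurable_EFinP; apply: measurableT_comp => //; exact: (measurable_integrable ip).
- apply: (measurable_fun_fubini_tonelli_F (A \+ B)%E) => //.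
    exact: emeasurable_funD.
  by move=> z; rewrite adde_ge0.
move=> s _.
have ius := integrable_mul_poisson s e0 iu.
have mus : measurable_fun setT (fun t : measurableTypeR R => u t * poisson e (s - t)).
  exact: measurable_integrable.
rewrite normrM EFinM.
apply: (@le_trans _ _ (`|u s|%:E * \int[mu]_t `|u t * poisson e (s - t)|%:E)%E).
  apply: lee_pmul => //.
  have /fineK <- := integrable_fin_num measurableT (integrable_norm ius).
  by rewrite lee_fin; exact: (le_normr_Rintegral measurableT ius).
rewrite -ge0_integralZl//; last first.
  by apply/measurable_EFinP; exact: measurableT_comp.
apply: ge0_le_integral => //.
- by apply: measurable_funeM; apply/measurable_EFinP; exact: measurableT_comp.
- exact: emeasurable_funD.
move=> t _; rewrite /A /B/= -EFinD lee_fin normrM (ger0_norm (poisson_ge0 _ e0)).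
rewrite mulrA -mulrDr -mulrDl mulrA ler_wpM2r ?poisson_ge0//.
rewrite -(real_normK (num_real (u s))) -(real_normK (num_real (u t))).
have := sqr_ge0 (`|u s| - `|u t|); rewrite sqrrB => h; lra.
Qed.

(** Along [e = harmonic n] the weights increase to [1], so monotone convergence carries the Schur
    bound to the limit without presupposing that the transform is square integrable. *)
Lemma transform_energy_le u : mu.-integrable setT (EFin \o u) ->
  (transform_energy u <= (2 * pi)%:E * \int[mu]_t (u t ^+ 2)%:E)%E.
Proof.
move=> iu.
have mC := measurable_cos_transform iu.
have mS := measurable_sin_transform iu.
pose P w := cos_transform u w ^+ 2 + sin_transform u w ^+ 2.
have P0 w : 0 <= P w by rewrite addr_ge0 ?sqr_ge0.
have mP : measurable_fun setT P.
  by apply: measurable_funD; exact: measurable_funX.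
pose g n w := (abel (harmonic n) w * P w)%:E.
have g0 n w : (0 <= g n w)%E by rewrite lee_fin mulr_ge0 ?abel_ge0.
have mg n : measurable_fun setT (g n).
  by apply/measurable_EFinP; apply: measurable_funM => //; exact: measurable_abel.
have nd w : {homo g ^~ w : n m / (n <= m)%N >-> (n <= m)%E}.
  move=> n m nm; rewrite lee_fin ler_wpM2r// ler_expR lerN2 ler_wpM2r//.
  by rewrite lef_pV2 ?posrE// ler_nat.
have cg w : g n w @[n --> \oo] --> (P w)%:E.
  apply: cvg_EFin; first by apply: nearW.
  rewrite /= -[X in _ --> X]mul1r; apply: cvgM; last exact: cvg_cst.
  rewrite -expR0 -oppr0 -(mul0r `|w|).
  apply: (@cvg_comp _ _ _ (fun n => - (harmonic n * `|w|)) expR); last exact: continuous_expR.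
  by apply: cvgN; apply: cvgM; [exact: cvg_harmonic|exact: cvg_cst].
have := cvg_monotone_convergence (mu := mu) measurableT mg (fun n x _ => g0 n x) (fun x _ => nd x).
have -> : (\int[mu]_x limn (g ^~ x) = transform_energy u)%E.
  by apply: eq_integral => w _; apply/cvg_lim => //; exact: cg.
move=> h; rewrite -(cvg_lim _ h)//.
apply: lime_le; first by apply/cvg_ex; eexists; exact: h.
apply: nearW => n.
have e0 : 0 < harmonic n :> R by rewrite invr_gt0.
apply: le_trans (poisson_form_le e0 iu); rewrite -abel_parseval//.
rewrite /Rintegral fineK.
  by under [leRHS]eq_integral do rewrite -!expr2.
apply: integrable_fin_num => //.
pose N := \int[mu]_t `|u t|.
have := integrableZl measurableT (N ^+ 2 + N ^+ 2) (integrable_abel e0).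
apply: le_integrable => //.
  have := mg n; rewrite /g /P; under eq_fun do rewrite !expr2.
  by [].
move=> w _ /=; rewrite lee_fin -!expr2 !normrM mulrC ler_wpM2r//.
rewrite !ger0_norm ?addr_ge0 ?sqr_ge0// lerD//.
  rewrite -(real_normK (num_real (cos_transform u w))).
  by rewrite lerXn2r ?nnegrE// ?Rintegral_ge0// ?cos_transform_le.
rewrite -(real_normK (num_real (sin_transform u w))).
by rewrite lerXn2r ?nnegrE// ?Rintegral_ge0// ?sin_transform_le.
Qed.

End transform_energy.

(** * Recovering integrals over intervals *)

Section interval_integral.
Context {R : realType}.
Local Notation mu := (@lebesgue_measure R).
Implicit Types (u v : R -> R).

Let cvg_atan_pos (c : R) : 0 < c -> atan (c / harmonic n) @[n --> \oo] --> pi / 2.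
Proof.
move=> c0.
apply: (@cvg_comp _ _ _ (fun n => c / harmonic n) (@atan R) _ (pinfty_nbhs R));
  last exact: cvgy_atan.
apply/cvgryPge => A; near=> n.
rewrite /harmonic/= invrK mulrC -ler_pdivrMr// (@le_trans _ _ n%:R)//.
  by near: n; exact: nbhs_infty_ger.
by rewrite ler_nat.
Unshelve. all: by end_near. Qed.

Let cvg_atan_neg (c : R) : c < 0 -> atan (c / harmonic n) @[n --> \oo] --> - (pi / 2).
Proof.
move=> c0.
have -> : (fun n => atan (c / harmonic n)) = (fun n => - atan (- c / harmonic n)).
  by apply/funext => n; rewrite mulNr atanN opprK.
by apply: cvgN; apply: cvg_atan_pos; rewrite oppr_gt0.
Qed.

Let indic_poisson (a b e s : R) : 0 < e -> a < b ->
  \int[mu]_t ((\1_`[a, b] t : R) * poisson e (s - t)) =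
  2 * (atan ((b - s) / e) - atan ((a - s) / e)).
Proof.
move=> e0 ab.
transitivity (\int[mu]_(t in `[a, b]) poisson e (s - t)).
  rewrite [RHS]Rintegral_mkcond patch_indic.
  by apply: eq_Rintegral => t _ /=; rewrite mulrC.
by rewrite /Rintegral integral_poisson_itv.
Qed.

Let atanB_le (x y : R) : `|2 * (atan x - atan y)| <= 2 * pi.
Proof.
rewrite normrM ger0_norm// ler_wpM2l// ler_norml.
have := atan_gtNpi2 x; have := atan_gtNpi2 y.
have := atan_ltpi2 x; have := atan_ltpi2 y.
by move=> *; apply/andP; split; lra.
Qed.

(** Inside the interval the two arctangents tend to opposite limits, outside to equal ones. At an
    endpoint one of them stays at [0] and the limit is [pi], half the inner value; the endpoints are
    excluded, which costs a null set. *)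
Let cvg_indic_poisson (a b s : R) : a < b -> s != a -> s != b ->
  2 * (atan ((b - s) / harmonic n) - atan ((a - s) / harmonic n)) @[n --> \oo]
    --> 2 * pi * (\1_`[a, b] s : R).
Proof.
move=> ab sa sb; rewrite -mulrA.
apply: cvgM; first exact: cvg_cst.
rewrite indicE; have [h|h] := pselect (`[a, b]%classic s).
- have /andP[as' sb'] : a <= s <= b by move: h; rewrite /= in_itv.
  rewrite mem_set// mulr1 [X in _ --> X](_ : _ = pi / 2 - (- (pi / 2))); last by field.
  apply: cvgB.
    by apply: cvg_atan_pos; rewrite subr_gt0 lt_neqAle sb.
  by apply: cvg_atan_neg; rewrite subr_lt0 lt_neqAle eq_sym sa.
- have {}h : (s < a) || (b < s).
    by move: h => /= /negP; rewrite in_itv/= negb_and -!ltNge.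
  rewrite memNset ?mulr0; last first.
    rewrite /= in_itv/= => /andP[? ?]; move: h; rewrite !ltNge; apply/negP.
    by rewrite negb_or !negbK; apply/andP.
  case/orP : h => h.
    rewrite -(subrr (pi / 2)); apply: cvgB; apply: cvg_atan_pos; rewrite subr_gt0//.
    exact: lt_trans ab.
  rewrite -(subrr (- (pi / 2))); apply: cvgB; apply: cvg_atan_neg; rewrite subr_lt0//.
  exact: lt_trans h.
Qed.

Let ae_neq (a : R) : {ae mu, forall s : R, s != a}.
Proof.
exists [set a]; split => //; first by rewrite lebesgue_measure_set1.
by move=> s /= /negP; rewrite negbK => /eqP.
Qed.

(** Dominated convergence with majorant [2 * pi * |u|], which holds for all [n] because a difference
    of arctangents is at most [pi] in absolute value. *)
Let cvg_pairing u (a b : R) : a < b -> mu.-integrable setT (EFin \o u) ->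
  \int[mu]_s (u s * \int[mu]_t ((\1_`[a, b] t : R) * poisson (harmonic n) (s - t)))
    @[n --> \oo] --> 2 * pi * \int[mu]_(t in `[a, b]) u t.
Proof.
move=> ab iu.
have e0 n : 0 < harmonic n :> R by rewrite invr_gt0.
pose q n s : R := 2 * (atan ((b - s) / harmonic n) - atan ((a - s) / harmonic n)).
have mu_ := measurable_integrable iu.
have matan n (c : R) : measurable_fun setT (fun s : R => atan ((c - s) / harmonic n)).
  apply: (measurableT_comp (f := @atan R)).
    by apply: continuous_measurable_fun => x; exact: continuous_atan.
  by apply: measurable_funM => //; exact: measurable_funB.
have mq n : measurable_fun setT (q n).
  by apply: measurable_funM => //; exact: measurable_funB.
have mi : measurable_fun setT (fun s : R => 2 * pi * (\1_`[a, b] s : R)).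
  by apply: measurable_funM => //; exact: measurable_indic.
pose f_ n s := (u s * q n s)%:E.
pose f s := (u s * (2 * pi * (\1_`[a, b] s : R)))%:E.
pose g s := ((2 * pi)%:E * `|(u s)%:E|)%E.
have mf_ n : measurable_fun setT (f_ n).
  by apply/measurable_EFinP; exact: measurable_funM.
have mf : measurable_fun setT f.
  by apply/measurable_EFinP; exact: measurable_funM.
have ff : {ae mu, forall s, setT s -> f_ n s @[n --> \oo] --> f s}.
  apply: (@filterS2 _ _ (ae_filter_ringOfSetsType mu) _ _ _ _ (ae_neq a) (ae_neq b)) => s sa sb _.
  apply: cvg_EFin; first exact: nearW.
  by apply: cvgM; [exact: cvg_cst|exact: cvg_indic_poisson].
have ig : mu.-integrable setT g.
  by apply: integrableZl => //; exact: integrable_abse.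
have fg : {ae mu, forall s n, setT s -> (`|f_ n s| <= g s)%E}.
  apply: aeW => s n _; rewrite /f_ /g /= -EFinM lee_fin normrM mulrC ler_wpM2r//.
  exact: atanB_le.
have [ifi _ h] := @dominated_convergence _ (measurableTypeR R) R mu setT
  measurableT f_ f g mf_ mf ff ig fg.
have {}h : \int[mu]_s (u s * q n s) @[n --> \oo] -->
    \int[mu]_s (u s * (2 * pi * (\1_`[a, b] s : R))).
  by apply: fine_cvg; rewrite fineK//; exact: integrable_fin_num.
have -> : 2 * pi * \int[mu]_(t in `[a, b]) u t =
    \int[mu]_s (u s * (2 * pi * (\1_`[a, b] s : R))).
  rewrite Rintegral_mkcond patch_indic -RintegralZl//.
    by apply: eq_Rintegral => s _ /=; ring.
  apply: le_integrable (iu) => //.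
    by apply/measurable_EFinP; apply: measurable_funM => //; exact: measurable_indic.
  move=> s _ /=; rewrite lee_fin normrM ler_piMr// indicE.
  by case: (_ \in _); rewrite ?normr0 ?normr1.
apply: cvg_trans h; apply: near_eq_cvg; apply: nearW => n.
by apply: eq_Rintegral => s _; rewrite indic_poisson.
Qed.

Let amgm (l x y : R) : 0 < l -> `|x * y| <= l / 2 * y ^+ 2 + (2 * l)^-1 * x ^+ 2.
Proof.
move=> l0; rewrite normrM -(real_normK (num_real x)) -(real_normK (num_real y)).
set X := `|x|; set Y := `|y|.
rewrite -subr_ge0 (_ : _ - _ = (2 * l)^-1 * (l * Y - X) ^+ 2).
  by rewrite mulr_ge0 ?sqr_ge0// invr_ge0 mulr_ge0// ltW.
by field; rewrite gt_eqF.
Qed.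

(** Quantitative injectivity: Parseval's identity is applied to [u] and the indicator function of
    the interval, and the product is split by the weighted inequality [amgm]. The first term is
    [l / 2] times the bound [2 * pi * (b - a)] on the energy of the transform of the indicator
    function. Optimizing over [l] would give Cauchy-Schwarz; leaving [l] free makes square roots
    unnecessary. *)
Lemma integral_itv_le u (a b l : R) : a < b -> 0 < l ->
  mu.-integrable setT (EFin \o u) ->
  ((2 * pi * `|\int[mu]_(t in `[a, b]) u t|)%:E <=
   (l * pi * (b - a))%:E + ((2 * l)^-1)%:E * transform_energy u)%E.
Proof.
move=> ab l0 iu.
pose chi : R -> R := \1_`[a, b].
have ichi : mu.-integrable setT (EFin \o chi) by exact: integrable_indic_itv.
have chi2 : (transform_energy chi <= (2 * pi * (b - a))%:E)%E.
  apply: (le_trans (transform_energy_le ichi)).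
  rewrite [leRHS]EFinM lee_pmul2l ?lte_fin ?mulr_gt0 ?pi_gt0//.
  have -> : (\int[mu]_t (chi t ^+ 2)%:E = \int[mu]_t (chi t)%:E)%E.
    apply: eq_integral => t _; rewrite /chi indicE.
    by case: (_ \in _); rewrite ?expr0n ?expr1n.
  have -> : (\int[mu]_t (chi t)%:E = mu `[a, b]%classic)%E.
    by rewrite integral_indic// setIT.
  by rewrite lebesgue_measure_itv/= lte_fin ab EFinB.
have [->|fu] := eqVneq (transform_energy u) +oo%E.
  by rewrite gt0_muley ?addey ?leey// lte_fin invr_gt0 mulr_gt0.
have finu : transform_energy u \is a fin_num.
  by rewrite ge0_fin_numE ?transform_energy_ge0// ltey.
rewrite -(fineK finu) -EFinM -EFinD lee_fin.
have pi20 : 0 <= 2 * pi :> R by rewrite mulr_ge0// pi_ge0.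
rewrite -(ger0_norm pi20) -normrM.
set M := (X in _ <= X).
have cM : cst M n @[n --> \oo] --> M by exact: cvg_cst.
(* It suffices to bound the regularized pairings by the same [M] for every [n], which works because
   [abel] is at most [1]. *)
refine (ler_cvg_to (cvg_norm (cvg_pairing ab iu)) cM _).
apply: nearW => n.
have e0 : 0 < harmonic n :> R by rewrite invr_gt0.
rewrite -abel_parseval//.
set F := (fun w => _ * _).
pose P v w := cos_transform v w ^+ 2 + sin_transform v w ^+ 2.
have mP v : mu.-integrable setT (EFin \o v) -> measurable_fun setT (P v).
  by move=> iv; apply: measurable_funD; apply: measurable_funX;
    [exact: measurable_cos_transform|exact: measurable_sin_transform].
have P0 v w : 0 <= P v w by rewrite addr_ge0 ?sqr_ge0.
have mF : measurable_fun setT F.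
  apply: measurable_funM; first exact: measurable_abel.
  apply: measurable_funD; apply: measurable_funM.
  - exact: measurable_cos_transform.
  - exact: measurable_cos_transform.
  - exact: measurable_sin_transform.
  - exact: measurable_sin_transform.
have Fle w : `|F w| <= (l / 2) * P chi w + (2 * l)^-1 * P u w.
  rewrite /F normrM (ger0_norm (abel_ge0 _ _)).
  apply: (@le_trans _ _ `|cos_transform u w * cos_transform chi w +
                         sin_transform u w * sin_transform chi w|).
    by rewrite ler_piMl// abel_le1// ltW.
  rewrite (le_trans (ler_normD _ _))// /P !mulrDr addrACA lerD//.
  - exact: amgm.
  - exact: amgm.
have bound : (\int[mu]_w `|F w|%:E <=
    (l * pi * (b - a) + (2 * l)^-1 * fine (transform_energy u))%:E)%E.
  apply: (@le_trans _ _ (\int[mu]_w ((l / 2)%:E * (P chi w)%:E + ((2 * l)^-1)%:E * (P u w)%:E))%E).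
    apply: ge0_le_integral => //.
    - by apply/measurable_EFinP; exact: measurableT_comp.
    - by apply: emeasurable_funD; apply: measurable_funeM; apply/measurable_EFinP; exact: mP.
    - by move=> w _; rewrite -!EFinM -EFinD lee_fin.
  have l20 : (0 <= (l / 2)%:E)%E by rewrite lee_fin divr_ge0// ltW.
  have il0 : (0 <= ((2 * l)^-1)%:E)%E by rewrite lee_fin invr_ge0 mulr_ge0// ltW.
  rewrite ge0_integralD//; last 4 first.
  - by move=> w _; rewrite mule_ge0// lee_fin.
  - by apply: measurable_funeM; apply/measurable_EFinP; exact: mP.
  - by move=> w _; rewrite mule_ge0// lee_fin.
  - by apply: measurable_funeM; apply/measurable_EFinP; exact: mP.
  rewrite !ge0_integralZl//; last 4 first.
  - by apply/measurable_EFinP; exact: mP.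
  - by move=> w _; rewrite lee_fin.
  - by apply/measurable_EFinP; exact: mP.
  - by move=> w _; rewrite lee_fin.
  rewrite [leRHS]EFinD [X in (_ <= _ + X)%E]EFinM (fineK finu); apply: leeD => //.
  have -> : (l * pi * (b - a))%:E = ((l / 2)%:E * (2 * pi * (b - a))%:E)%E.
    by rewrite -EFinM; congr EFin; field.
  exact: lee_wpmul2l.
have iF : mu.-integrable setT (EFin \o F).
  apply/integrableP; split; first exact/measurable_EFinP.
  by apply: (le_lt_trans bound); rewrite ltry.
rewrite -lee_fin; apply: le_trans bound.
rewrite (EFin_normr_Rintegral _ iF)//.
apply: (@le_abse_integral _ (measurableTypeR R) _ mu setT (EFin \o F)) => //.
exact/measurable_EFinP.
Qed.

End interval_integral.

(** * Completeness of L^2 *)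

Lemma cvge0_leP (R : realType) (u : nat -> \bar R) : (forall n, 0 <= u n)%E ->
  (u n @[n --> \oo] --> 0%E) <->
  (forall e : R, 0 < e -> exists N, forall n, (N <= n)%N -> (u n <= e%:E)%E).
Proof.
move=> u0; split => [/fine_cvgP[[M _ Mfin] /cvgrPdist_le h] e e0|h].
  have [N _ NP] := h _ e0; exists (maxn M N) => n; rewrite geq_max => /andP[Mn Nn].
  rewrite -(fineK (Mfin n Mn)) lee_fin.
  by have := NP n Nn; rewrite /= sub0r normrN => /(le_trans (ler_norm _)).
have fin n : (u n <= 1%:E)%E -> u n \is a fin_num.
  by move=> un; rewrite ge0_fin_numE// (le_lt_trans un)// ltry.
apply/fine_cvgP; split.
  have [N NP] := h 1 ltr01; exists N => // n /= Nn; apply: fin; exact: NP.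
apply/cvgrPdist_le => e e0.
have [M MP] := h 1 ltr01; have [N NP] := h e e0.
exists (maxn M N) => // n /=; rewrite geq_max => /andP[Mn Nn].
rewrite sub0r normrN ger0_norm ?fine_ge0//.
rewrite -lee_fin fineK; first exact: NP.
by apply: fin; exact: MP.
Qed.

Section riesz_fischer.
Context d (T : measurableType d) (R : realType) (mu : {measure set T -> \bar R}).

Let telescope_cvg (g : nat -> R) (C : R) :
  (forall k, `|g k.+1 - g k| <= C / 2 ^+ k) -> cvgn g.
Proof.
move=> gC.
have h : cvgn (series (fun k => g k.+1 - g k)).
  apply: normed_cvg.
  apply: (@series_le_cvg _ _ (geometric C 2^-1)) => //.
  - by move=> n /=.
  - move=> n; rewrite /= mulr_ge0 ?exprn_ge0 ?invr_ge0//.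
    by have := le_trans (normr_ge0 _) (gC 0%N); rewrite expr0 divr1.
  - by move=> n; rewrite /= exprVn; exact: gC.
  - by apply: is_cvg_geometric_series; rewrite ger0_norm ?invr_ge0// invf_lt1// ltr1n.
have -> : g = (fun n => series (fun k => g k.+1 - g k) n + g 0%N).
  apply/funext => n; rewrite /series/= telescope_sumr//.
  by rewrite subrK.
apply: is_cvgD => //; exact: is_cvg_cst.
Qed.

Let limn_einf_le (u : nat -> \bar R) (x : \bar R) :
  (\forall n \near \oo, (u n <= x)%E) -> (limn_einf u <= x)%E.
Proof.
move=> [N _ uN]; rewrite limn_einf_lim; apply: lime_le.
  exact: is_cvg_einfs.
near=> n; apply: (@le_trans _ _ (u n)); first by apply: ereal_inf_lbound; exists n => /=.
by apply: uN => /=; near: n; exact: nbhs_infty_ge.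
Unshelve. all: by end_near. Qed.

(** Riesz-Fischer: a rapidly Cauchy subsequence converges almost everywhere, and Fatou's lemma along
    it, with [n] fixed, turns the Cauchy bound into a bound on the distance to the limit. *)
Lemma L2_complete (f_ : nat -> T -> R) :
  (forall n, measurable_fun setT (f_ n)) ->
  (forall e : R, 0 < e -> exists N, forall n m, (N <= n)%N -> (N <= m)%N ->
     (\int[mu]_x ((f_ n x - f_ m x) ^+ 2)%:E <= e%:E)%E) ->
  exists2 f : T -> R, measurable_fun setT f &
    (\int[mu]_x ((f_ n x - f x) ^+ 2)%:E)%E @[n --> \oo] --> 0%E.
Proof.
move=> mf_ cauchy.
have /choice[N NP] : forall k, exists N, forall n m, (N <= n)%N -> (N <= m)%N ->
    (\int[mu]_x ((f_ n x - f_ m x) ^+ 2)%:E <= ((8 ^+ k)^-1)%:E)%E.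
  by move=> k; apply: cauchy; rewrite invr_gt0 exprn_gt0.
(* The sum puts [phi m] above [N k] for every [k <= m]; the summand [k] makes [phi] tend to
   infinity. *)
pose phi k := (k + \sum_(i < k.+1) N i)%N.
have phi_ge k m : (k <= m)%N -> (N k <= phi m)%N.
  move=> km; rewrite /phi addnC (bigD1 (Ordinal (km : (k < m.+1)%N)))//=.
  by rewrite -addnA leq_addr.
pose g k := f_ (phi k).
have mg k : measurable_fun setT (g k) by exact: mf_.
(* The bound [8 ^- k] is shared out: after the weight [4 ^+ k] the integrals are still summable,
   being at most [2 ^- k], and finiteness of the sum [H x] gives increments of size at most
   [sqrt (H x) / 2 ^+ k]. This avoids Minkowski's inequality. *)
pose h k x := (4 ^+ k * (g k.+1 x - g k x) ^+ 2)%:E.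
have h0 k x : (0 <= h k x)%E by rewrite lee_fin mulr_ge0 ?sqr_ge0 ?exprn_ge0.
have mh k : measurable_fun setT (h k).
  apply/measurable_EFinP; apply: measurable_funM => //.
  by apply: measurable_funX; exact: measurable_funB.
have ih k : (\int[mu]_x h k x <= ((2 ^+ k)^-1)%:E)%E.
  under eq_integral do rewrite /h EFinM.
  rewrite ge0_integralZl_EFin ?exprn_ge0//; last 2 first.
  - by move=> x _; rewrite lee_fin sqr_ge0.
  - apply/measurable_EFinP; apply: measurable_funX; exact: measurable_funB.
  have := NP k (phi k.+1) (phi k) (phi_ge _ _ (leqnSn k)) (phi_ge _ _ (leqnn k)).
  have p0 : (0 <= (4 ^+ k : R)%:E)%E by rewrite lee_fin exprn_ge0.
  move=> /(lee_wpmul2l p0)/le_trans; apply.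
  rewrite -EFinM lee_fin -!exprVn -exprMn.
  by rewrite (_ : 4 * 8^-1 = 2^-1 :> R)//; lra.
pose H x := (\sum_(k <oo) h k x)%E.
have H0 x : (0 <= H x)%E by exact: nneseries_ge0.
have mH : measurable_fun setT H.
  by apply: ge0_emeasurable_sum.
have iH : mu.-integrable setT H.
  apply/integrableP; split => //.
  under eq_integral do rewrite gee0_abs//.
  rewrite /H integral_nneseries//.
  apply: (@le_lt_trans _ _ (\sum_(k <oo) ((2 ^+ k)^-1)%:E)%E).
    by apply: lee_nneseries => // k _ _; exact: integral_ge0.
  apply: (@le_lt_trans _ _ 2%:E); last exact: ltry.
  apply: lime_le; first by apply: is_cvg_nneseries => k _ _; rewrite lee_fin invr_ge0 exprn_ge0.
  apply: nearW => n; rewrite sumEFin lee_fin.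
  suff -> : \sum_(0 <= i < n) (2 ^+ i)^-1 = 2 - 2 / 2 ^+ n :> R.
    by rewrite gerBl divr_ge0// exprn_ge0.
  elim: n => [|n IHn]; first by rewrite big_nil expr0 divr1 subrr.
  rewrite big_nat_recr//= IHn exprS; field.
  by rewrite expf_neq0.
have [Z [mZ Z0 HZ]] := integrable_ae measurableT iH.
have cg x : ~ Z x -> cvgn (g ^~ x).
  move=> nZx; have Hx : H x \is a fin_num.
    by apply: contrapT => nH; apply: nZx; apply: HZ => /=; move/(_ I).
  apply: (@telescope_cvg _ (Num.sqrt (fine (H x)))) => k.
  have : (h k x <= H x)%E.
    apply: le_trans (nneseries_lim_ge (m := 0) k.+1 (fun n _ _ => h0 n x)).
    rewrite big_nat_recr//= leeDr// sume_ge0// => i _; exact: h0.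
  rewrite -(fineK Hx) lee_fin => hH.
  have p2 : (0 : R) < 2 ^+ k by rewrite exprn_gt0.
  rewrite ler_pdivlMr//.
  rewrite -sqrtr_sqr -{1}(ger0_norm (ltW p2)) -{1}sqrtr_sqr -sqrtrM ?sqr_ge0//.
  rewrite ler_wsqrtr// mulrC -exprM mulnC exprM.
  by rewrite (_ : 2 ^+ 2 = 4 :> R)//; ring.
(* Setting the sequence to [0] on the null set [Z] makes it converge everywhere, so that its limit
   is measurable. *)
pose g' k x := g k x * \1_(~` Z) x.
have cg' x : cvgn (g' ^~ x).
  have [Zx|nZx] := pselect (Z x).
    rewrite (_ : g' ^~ x = cst 0); first exact: is_cvg_cst.
    by apply/funext => k; rewrite /g' indicE memNset ?mulr0//= => /(_ Zx).
  rewrite (_ : g' ^~ x = g ^~ x); first exact: cg.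
  by apply/funext => k; rewrite /g' indicE mem_set ?mulr1.
pose f x := limn (g' ^~ x).
have mf : measurable_fun setT f.
  apply: (@measurable_fun_cvg _ _ _ _ g') => //.
  move=> k; apply: measurable_funM => //.
  by apply: measurable_indic; exact: measurableC.
exists f; first by [].
have ge0 n : (0 <= \int[mu]_x ((f_ n x - f x) ^+ 2)%:E)%E.
  by apply: integral_ge0 => x _; rewrite lee_fin sqr_ge0.
apply/(cvge0_leP ge0) => e e0.
have [M MP] := cauchy _ e0; exists M => n Mn.
pose G k x := ((f_ n x - g k x) ^+ 2)%:E.
have mG k : measurable_fun setT (G k).
  by apply/measurable_EFinP; apply: measurable_funX; exact: measurable_funB.
have G0 k x : (0 <= G k x)%E by rewrite lee_fin sqr_ge0.
have := fatou mu measurableT mG (fun k x _ => G0 k x).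
have -> : (\int[mu]_x limn_einf (G ^~ x) = \int[mu]_x ((f_ n x - f x) ^+ 2)%:E)%E.
  apply: ge0_ae_eq_integral => //.
  - apply: (measurableT_comp (f := -%E)) => //.
    by apply: measurable_fun_limn_esup => k; exact: measurableT_comp.
  - by apply/measurable_EFinP; apply: measurable_funX; exact: measurable_funB.
  - move=> x _; rewrite limn_einf_lim; apply: lime_ge; first exact: is_cvg_einfs.
    by apply: nearW => n'; apply: le_ereal_inf_tmp => _ [m _ <-]; exact: G0.
  - by move=> x _; rewrite lee_fin sqr_ge0.
  - exists Z; split => // x /= /not_implyP[_ nx]; apply: contrapT => nZx; apply: nx.
    have gf : g k x @[k --> \oo] --> f x.
      have := cg' x; rewrite /f (_ : g' ^~ x = g ^~ x)//.
      by apply/funext => k; rewrite /g' indicE mem_set ?mulr1.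
    suff /cvg_limn_einf_sup[] : G k x @[k --> \oo] --> ((f_ n x - f x) ^+ 2)%:E by [].
    apply: cvg_EFin; first exact: nearW.
    by rewrite /= !expr2; apply: cvgM; apply: cvgB => //; exact: cvg_cst.
move=> h1; apply: (le_trans h1); apply: limn_einf_le.
near=> k; apply: MP => //; apply: (@leq_trans k).
  by near: k; exact: nbhs_infty_ge.
exact: leq_addr.
Unshelve. all: by end_near. Qed.

End riesz_fischer.

(** * Complex signals *)

Section complex_signals.
Context {R : realType}.
Local Notation mu := (@lebesgue_measure R).
Implicit Types (f g h F G : R -> R[i]).

Local Notation re f := (fun t => complex.Re (f t)).
Local Notation im f := (fun t => complex.Im (f t)).

Lemma ReB (x y : R[i]) : complex.Re (x - y) = complex.Re x - complex.Re y.
Proof. by case: x y => [a b] []. Qed.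

Lemma ImB (x y : R[i]) : complex.Im (x - y) = complex.Im x - complex.Im y.
Proof. by case: x y => [a b] []. Qed.

Lemma sqr_normcE (x : R[i]) :
  normc x ^+ 2 = complex.Re x ^+ 2 + complex.Im x ^+ 2.
Proof. by case: x => a b; rewrite /normc sqr_sqrtr// addr_ge0 ?sqr_ge0. Qed.

(** A triangle inequality for squared norms, at the price of a factor [2]. This is the origin of
    [e / 4] in the estimates below: two terms, each doubled. *)
Lemma sqr_normcB_le (x y z : R[i]) :
  normc (x - z) ^+ 2 <= 2 * normc (x - y) ^+ 2 + 2 * normc (y - z) ^+ 2.
Proof.
rewrite !sqr_normcE !ReB !ImB.
set a := complex.Re x; set b := complex.Re y; set c := complex.Re z.
set a' := complex.Im x; set b' := complex.Im y; set c' := complex.Im z.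
have := sqr_ge0 (a - b - (b - c)); have := sqr_ge0 (a' - b' - (b' - c')).
by rewrite !expr2 => h1 h2; lra.
Qed.

Lemma cmeasurableB f g : cmeasurable f -> cmeasurable g ->
  cmeasurable (fun t => f t - g t).
Proof.
move=> [f1 f2] [g1 g2]; split.
  by under eq_fun do rewrite ReB; exact: measurable_funB.
by under eq_fun do rewrite ImB; exact: measurable_funB.
Qed.

Lemma measurable_sqr_normc f : cmeasurable f ->
  measurable_fun setT (fun t => normc (f t) ^+ 2).
Proof.
move=> [f1 f2]; under eq_fun do rewrite sqr_normcE.
by apply: measurable_funD; exact: measurable_funX.
Qed.

Lemma energy_ge0 f : (0 <= energy f)%E.
Proof. by apply: integral_ge0 => t _; rewrite lee_fin sqr_ge0. Qed.

Lemma energyE f : cmeasurable f -> energy f =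
  (\int[mu]_t (complex.Re (f t) ^+ 2)%:E + \int[mu]_t (complex.Im (f t) ^+ 2)%:E)%E.
Proof.
move=> [f1 f2]; rewrite -ge0_integralD//.
- by apply: eq_integral => t _; rewrite sqr_normcE.
- by move=> t _; rewrite lee_fin sqr_ge0.
- by apply/measurable_EFinP; exact: measurable_funX.
- by move=> t _; rewrite lee_fin sqr_ge0.
- by apply/measurable_EFinP; exact: measurable_funX.
Qed.

Lemma energyB_le f g h : cmeasurable f -> cmeasurable g -> cmeasurable h ->
  (energy (fun t => f t - h t)%R <=
   2%:E * energy (fun t => f t - g t)%R + 2%:E * energy (fun t => g t - h t)%R)%E.
Proof.
move=> mf mg mh.
have mfg := measurable_sqr_normc (cmeasurableB mf mg).
have mgh := measurable_sqr_normc (cmeasurableB mg mh).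
have mfh := measurable_sqr_normc (cmeasurableB mf mh).
rewrite -!ge0_integralZl_EFin//; last 4 first.
- by move=> t _; rewrite lee_fin sqr_ge0.
- exact/measurable_EFinP.
- by move=> t _; rewrite lee_fin sqr_ge0.
- exact/measurable_EFinP.
rewrite -ge0_integralD//; last 4 first.
- by move=> t _; rewrite -EFinM lee_fin mulr_ge0 ?sqr_ge0.
- by apply: measurable_funeM; exact/measurable_EFinP.
- by move=> t _; rewrite -EFinM lee_fin mulr_ge0 ?sqr_ge0.
- by apply: measurable_funeM; exact/measurable_EFinP.
apply: ge0_le_integral => //.
- by move=> t _; rewrite lee_fin sqr_ge0.
- exact/measurable_EFinP.
- by apply: emeasurable_funD; apply: measurable_funeM; exact/measurable_EFinP.
- by move=> t _; rewrite -!EFinM -EFinD lee_fin sqr_normcB_le.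
Qed.

Lemma energyBC f g : energy (fun t => f t - g t) = energy (fun t => g t - f t).
Proof. by apply: eq_integral => t _; rewrite -normcN opprB. Qed.

Lemma energy0_ae f : cmeasurable f -> energy f = 0%E ->
  {ae mu, forall t, f t = 0}.
Proof.
move=> mf Ef.
have mn : measurable_fun setT (fun t => (normc (f t) ^+ 2)%:E).
  by apply/measurable_EFinP; exact: measurable_sqr_normc.
have /(ae_eq_integral_abs mu measurableT mn) : (\int[mu]_t `|(normc (f t) ^+ 2)%:E| = 0)%E.
  by rewrite -Ef; apply: eq_integral => t _; rewrite gee0_abs// lee_fin sqr_ge0.
apply: filterS => t /(_ I) -[] /eqP.
by rewrite sqrf_eq0 => /eqP; exact: eq0_normc.
Qed.

Lemma cvg_L2P (f_ : nat -> R -> R[i]) f : cvg_L2 f_ f <->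
  (forall e : R, 0 < e -> exists N, forall n, (N <= n)%N ->
    (energy (fun t => f_ n t - f t)%R <= e%:E)%E).
Proof. by apply: cvge0_leP => n; exact: energy_ge0. Qed.

(** With [g_] equal to [f_] this is the Cauchy property; with two different sequences it yields
    independence of the approximating sequence. *)
Lemma cvg_L2_dist (f_ g_ : nat -> R -> R[i]) h :
  (forall n, cmeasurable (f_ n)) -> (forall n, cmeasurable (g_ n)) ->
  cmeasurable h -> cvg_L2 f_ h -> cvg_L2 g_ h ->
  forall e : R, 0 < e -> exists N, forall n m, (N <= n)%N -> (N <= m)%N ->
    (energy (fun t => f_ n t - g_ m t)%R <= e%:E)%E.
Proof.
move=> mf mg mh /cvg_L2P fh /cvg_L2P gh e e0.
have e40 : 0 < e / 4 by rewrite divr_gt0.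
have [N NP] := fh _ e40; have [M MP] := gh _ e40.
exists (maxn N M) => n m; rewrite !geq_max => /andP[Nn _] /andP[_ Mm].
apply: (le_trans (energyB_le (mf n) mh (mg m))).
have -> : (e%:E = 2%:E * (e / 4)%:E + 2%:E * (e / 4)%:E)%E.
  by rewrite -EFinM -EFinD; congr EFin; field.
apply: leeD; apply: lee_wpmul2l; rewrite ?lee_fin//.
  exact: NP.
by rewrite energyBC; exact: MP.
Qed.

Lemma cvg_L2_trans (F_ G_ : nat -> R -> R[i]) F :
  (forall n, cmeasurable (F_ n)) -> (forall n, cmeasurable (G_ n)) ->
  cmeasurable F -> energy (fun t => F_ n t - G_ n t) @[n --> \oo] --> 0%E ->
  cvg_L2 G_ F -> cvg_L2 F_ F.
Proof.
move=> mF mG mf /cvge0_leP FG /cvg_L2P GF; apply/cvg_L2P => e e0.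
have e40 : 0 < e / 4 by rewrite divr_gt0.
have [N NP] := FG (fun n => energy_ge0 _) _ e40; have [M MP] := GF _ e40.
exists (maxn N M) => n; rewrite !geq_max => /andP[Nn Mn].
apply: (le_trans (energyB_le (mF n) (mG n) mf)).
have -> : (e%:E = 2%:E * (e / 4)%:E + 2%:E * (e / 4)%:E)%E.
  by rewrite -EFinM -EFinD; congr EFin; field.
by apply: leeD; apply: lee_wpmul2l; rewrite ?lee_fin//; [exact: NP|exact: MP].
Qed.

Lemma cvg_L2_unique (f_ : nat -> R -> R[i]) f g :
  (forall n, cmeasurable (f_ n)) -> cmeasurable f -> cmeasurable g ->
  cvg_L2 f_ f -> cvg_L2 f_ g -> {ae mu, forall t, f t = g t}.
Proof.
move=> mf_ mf mg /cvg_L2P ff /cvg_L2P fg.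
have : {ae mu, forall t, f t - g t = 0}.
  apply: energy0_ae; first exact: cmeasurableB.
  apply/eqP; rewrite eq_le energy_ge0 andbT; apply/lee_addgt0Pr => e e0.
  rewrite add0e.
  have e40 : 0 < e / 4 by rewrite divr_gt0.
  have [N NP] := ff _ e40; have [M MP] := fg _ e40.
  apply: (le_trans (energyB_le mf (mf_ (maxn N M)) mg)).
  have -> : (e%:E = 2%:E * (e / 4)%:E + 2%:E * (e / 4)%:E)%E.
    by rewrite -EFinM -EFinD; congr EFin; field.
  apply: leeD; apply: lee_wpmul2l; rewrite ?lee_fin//.
    by rewrite energyBC; apply: NP; rewrite leq_maxl.
  by apply: MP; rewrite leq_maxr.
by apply: (@filterS _ _ (ae_filter_ringOfSetsType mu)) => t /eqP; rewrite subr_eq0 => /eqP.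
Qed.

Lemma cL2_complete (f_ : nat -> R -> R[i]) :
  (forall n, cmeasurable (f_ n)) ->
  (forall e : R, 0 < e -> exists N, forall n m, (N <= n)%N -> (N <= m)%N ->
    (energy (fun t => f_ n t - f_ m t)%R <= e%:E)%E) ->
  exists2 f, cmeasurable f & cvg_L2 f_ f.
Proof.
move=> mf_ cauchy.
have [|u mu_ cu] := @L2_complete _ (measurableTypeR R) R mu
    (fun n => re (f_ n)) (fun n => (mf_ n).1).
  move=> e e0; have [N NP] := cauchy e e0; exists N => n m Nn Nm.
  apply: le_trans (NP n m Nn Nm); rewrite energyE; last exact: cmeasurableB.
  under [X in (_ <= X + _)%E]eq_integral do rewrite ReB.
  by rewrite leeDl//; apply: integral_ge0 => x _; rewrite lee_fin sqr_ge0.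
have [|v mv cv] := @L2_complete _ (measurableTypeR R) R mu
    (fun n => im (f_ n)) (fun n => (mf_ n).2).
  move=> e e0; have [N NP] := cauchy e e0; exists N => n m Nn Nm.
  apply: le_trans (NP n m Nn Nm); rewrite energyE; last exact: cmeasurableB.
  under [X in (_ <= _ + X)%E]eq_integral do rewrite ImB.
  by rewrite leeDr//; apply: integral_ge0 => x _; rewrite lee_fin sqr_ge0.
exists (fun t => (u t +i* v t)%C); first by [].
rewrite /cvg_L2 (_ : (fun n => _) = (fun n =>
    \int[mu]_x ((complex.Re (f_ n x) - u x) ^+ 2)%:E +
    \int[mu]_x ((complex.Im (f_ n x) - v x) ^+ 2)%:E)%E).
  by rewrite -(adde0 0%E); apply: cvgeD.
apply/funext => n; rewrite energyE; last exact: cmeasurableB.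
by congr (_ + _)%E; apply: eq_integral => t _; rewrite ?ReB ?ImB.
Qed.

Lemma fourier_integralE f w : cintegrable f ->
  fourier_integral f w =
    ((cos_transform (re f) w + sin_transform (im f) w) +i*
     (cos_transform (im f) w - sin_transform (re f) w))%C.
Proof.
move=> [iu iv]; rewrite /fourier_integral /cintegral.
rewrite /cos_transform /sin_transform.
congr (_ +i* _)%C.
  rewrite -RintegralD//; [|exact: integrable_mul_cos|exact: integrable_mul_sin].
  by apply: eq_Rintegral => t _; case: (f t) => a b /=; ring.
rewrite -RintegralB//; [|exact: integrable_mul_cos|exact: integrable_mul_sin].
by apply: eq_Rintegral => t _; case: (f t) => a b /=; ring.
Qed.

Lemma cmeasurable_fourier_integral f : cintegrable f ->
  cmeasurable (fourier_integral f).
Proof.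
move=> cf; have [iu iv] := cf; split; under eq_fun do rewrite fourier_integralE//=.
  apply: measurable_funD; first exact: measurable_cos_transform.
  exact: measurable_sin_transform.
apply: measurable_funB; first exact: measurable_cos_transform.
exact: measurable_sin_transform.
Qed.

Lemma cintegrableB f g : cintegrable f -> cintegrable g ->
  cintegrable (fun t => f t - g t).
Proof.
move=> [f1 f2] [g1 g2]; split.
  have := integrableB measurableT f1 g1.
  by apply: eq_integrable => // t _ /=; rewrite ReB EFinB.
have := integrableB measurableT f2 g2.
by apply: eq_integrable => // t _ /=; rewrite ImB EFinB.
Qed.

Lemma fourier_integralB f g w : cintegrable f -> cintegrable g ->
  fourier_integral (fun t => f t - g t) w =
  fourier_integral f w - fourier_integral g w.
Proof.
move=> cf cg; rewrite !fourier_integralE//; last exact: cintegrableB.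
have [f1 f2] := cf; have [g1 g2] := cg.
have cB (u v : R -> R) : mu.-integrable setT (EFin \o u) -> mu.-integrable setT (EFin \o v) ->
    cos_transform (fun t => u t - v t) w = cos_transform u w - cos_transform v w.
  move=> iu iv; rewrite /cos_transform -RintegralB//; try exact: integrable_mul_cos.
  by apply: eq_Rintegral => t _; rewrite mulrBl.
have sB (u v : R -> R) : mu.-integrable setT (EFin \o u) -> mu.-integrable setT (EFin \o v) ->
    sin_transform (fun t => u t - v t) w = sin_transform u w - sin_transform v w.
  move=> iu iv; rewrite /sin_transform -RintegralB//; try exact: integrable_mul_sin.
  by apply: eq_Rintegral => t _; rewrite mulrBl.
have -> : re (fun t => f t - g t) = (fun t => complex.Re (f t) - complex.Re (g t)).
  by apply/funext => t; rewrite ReB.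
have -> : im (fun t => f t - g t) = (fun t => complex.Im (f t) - complex.Im (g t)).
  by apply/funext => t; rewrite ImB.
rewrite !cB// !sB//; apply/eqP; rewrite eq_complex/=; apply/andP; split; apply/eqP; ring.
Qed.

(* The cosine transform is even and the sine transform odd, so that averaging
   over [w] and [- w] cancels the products of the real part with the imaginary
   part. *)
Lemma energy_fourier_integral f : cintegrable f ->
  energy (fourier_integral f) =
  (transform_energy (re f) + transform_energy (im f))%E.
Proof.
move=> cf; have [iu iv] := cf.
pose E w := (normc (fourier_integral f w) ^+ 2)%:E.
have E0 w : (0 <= E w)%E by rewrite lee_fin sqr_ge0.
have mE : measurable_fun setT E.
  by apply/measurable_EFinP; apply: measurable_sqr_normc; exact: cmeasurable_fourier_integral.
have mEN : measurable_fun setT (fun w : R => E (0 - w)).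
  by apply: (measurableT_comp mE); exact: measurable_funB.
have cN (u : R -> R) w : cos_transform u (- w) = cos_transform u w.
  by apply: eq_Rintegral => t _; rewrite mulNr cosN.
have sN (u : R -> R) w : mu.-integrable setT (EFin \o u) ->
    sin_transform u (- w) = - sin_transform u w.
  move=> i; rewrite -[RHS]mulN1r /sin_transform -RintegralZl//; last exact: integrable_mul_sin.
    by apply: eq_Rintegral => t _; rewrite mulNr sinN; ring.
have mP (u : R -> R) : mu.-integrable setT (EFin \o u) ->
    measurable_fun setT (fun w => (cos_transform u w ^+ 2 + sin_transform u w ^+ 2)%:E).
  move=> i; apply/measurable_EFinP; apply: measurable_funD; apply: measurable_funX.
    exact: measurable_cos_transform.
  exact: measurable_sin_transform.
have half : (energy (fourier_integral f) =
    \int[mu]_w (2^-1%:E * E w + 2^-1%:E * E (0 - w)%R))%E.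
  rewrite ge0_integralD//; last 4 first.
  - by move=> w _; rewrite mule_ge0.
  - exact: measurable_funeM.
  - by move=> w _; rewrite mule_ge0.
  - exact: measurable_funeM.
  rewrite !ge0_integralZl_EFin// ge0_integral_reflect// -ge0_muleDl ?lee_fin//.
  by rewrite -EFinD (_ : 2^-1 + 2^-1 = 1)%R ?mul1e//; field.
rewrite half -ge0_integralD//; last 4 first.
- by move=> w _; rewrite lee_fin addr_ge0 ?sqr_ge0.
- exact: mP.
- by move=> w _; rewrite lee_fin addr_ge0 ?sqr_ge0.
- exact: mP.
apply: eq_integral => w _; rewrite /E sub0r !fourier_integralE// !sqr_normcE/=.
rewrite !cN !sN// -!EFinM -!EFinD; by congr EFin; field.
Qed.

Lemma energy_fourier_integral_le f : cintegrable f ->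
  (energy (fourier_integral f) <= (2 * pi)%:E * energy f)%E.
Proof.
move=> cf; have [iu iv] := cf.
rewrite energy_fourier_integral// energyE; last first.
  by split; exact: measurable_integrable.
rewrite ge0_muleDr; try by apply: integral_ge0 => t _; rewrite lee_fin sqr_ge0.
by apply: leeD; exact: transform_energy_le.
Qed.

End complex_signals.

(** * The Fourier transform on L^2 *)

Section plancherel.
Context {R : realType}.
Local Notation mu := (@lebesgue_measure R).
Implicit Types (f g h F G : R -> R[i]).

Local Notation re f := (fun t => complex.Re (f t)).
Local Notation im f := (fun t => complex.Im (f t)).
Local Notation I n := (`[- n%:R, n%:R]%classic : set R).

(** Cutting to a bounded interval puts a square-integrable signal into both L^1 and L^2, which
    provides one explicit approximating sequence for every signal. *)
Definition truncation (n : nat) f : R -> R[i] := fun t =>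
  ((complex.Re (f t) * \1_(I n) t) +i* (complex.Im (f t) * \1_(I n) t))%C.

Let indic01 n (t : R) : (\1_(I n) t : R) = 0 \/ (\1_(I n) t : R) = 1.
Proof. by rewrite indicE; case: (_ \in _); [right|left]. Qed.

Let measurable_indicI n : measurable_fun setT (\1_(I n) : R -> R).
Proof. exact: measurable_indic. Qed.

Let cmeasurable_truncation n f : cmeasurable f -> cmeasurable (truncation n f).
Proof. by move=> [f1 f2]; split; exact: measurable_funM. Qed.

(** On the interval [|u|] is at most [1 + u ^+ 2], so the indicator function plus [u ^+ 2] is an
    integrable majorant. *)
Let integrable_truncated n (u : R -> R) : measurable_fun setT u ->
  (\int[mu]_t (u t ^+ 2)%:E < +oo)%E ->
  mu.-integrable setT (EFin \o (fun t => u t * \1_(I n) t)).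
Proof.
move=> mu_ u2.
have iu2 : mu.-integrable setT (EFin \o (fun t => u t ^+ 2)).
  apply/integrableP; split; first by apply/measurable_EFinP; exact: measurable_funX.
  by under eq_integral do rewrite gee0_abs ?lee_fin ?sqr_ge0//.
have i1 := @integrable_indic_itv R (- n%:R) n%:R true false.
have := integrableD measurableT i1 iu2.
apply: le_integrable => //.
  by apply/measurable_EFinP; exact: measurable_funM.
move=> t _; rewrite /= lee_fin.
have [->|->] := indic01 n t; first by rewrite mulr0 normr0.
rewrite mulr1 [leRHS]ger0_norm; last by rewrite addr_ge0 ?sqr_ge0.
rewrite -(real_normK (num_real (u t))).
have := sqr_ge0 (`|u t| - 1); have := normr_ge0 (u t).
by rewrite !expr2 => h1 h2; lra.
Qed.

Let energy_re f : cmeasurable f ->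
  (\int[mu]_t (complex.Re (f t) ^+ 2)%:E <= energy f)%E.
Proof.
move=> mf; rewrite energyE// leeDl//.
by apply: integral_ge0 => x _; rewrite lee_fin sqr_ge0.
Qed.

Let energy_im f : cmeasurable f ->
  (\int[mu]_t (complex.Im (f t) ^+ 2)%:E <= energy f)%E.
Proof.
move=> mf; rewrite energyE// leeDr//.
by apply: integral_ge0 => x _; rewrite lee_fin sqr_ge0.
Qed.

Let cintegrable_truncation n f : square_integrable f ->
  cintegrable (truncation n f).
Proof.
move=> [mf ef]; have [f1 f2] := mf; split.
  by apply: (integrable_truncated n f1); exact: le_lt_trans (energy_re mf) ef.
by apply: (integrable_truncated n f2); exact: le_lt_trans (energy_im mf) ef.
Qed.

Let square_integrable_truncation n f : square_integrable f ->
  square_integrable (truncation n f).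
Proof.
move=> [mf ef]; split; first exact: cmeasurable_truncation.
apply: le_lt_trans ef; apply: ge0_le_integral => //.
- by move=> t _; rewrite lee_fin sqr_ge0.
- apply/measurable_EFinP; apply: measurable_sqr_normc.
  exact: cmeasurable_truncation.
- by apply/measurable_EFinP; exact: measurable_sqr_normc.
move=> t _; rewrite lee_fin !sqr_normcE/=.
have [->|->] := indic01 n t; last by rewrite !mulr1.
by rewrite !mulr0 expr0n addr0 addr_ge0 ?sqr_ge0.
Qed.

Let cvg_truncation f : square_integrable f -> cvg_L2 (truncation ^~ f) f.
Proof.
move=> [mf ef].
pose d_ n t := (normc (truncation n f t - f t) ^+ 2)%:E.
pose g t := (normc (f t) ^+ 2)%:E.
have md_ n : measurable_fun setT (d_ n).
  apply/measurable_EFinP; apply: measurable_sqr_normc.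
  by apply: cmeasurableB => //; exact: cmeasurable_truncation.
have mg : measurable_fun setT g.
  by apply/measurable_EFinP; exact: measurable_sqr_normc.
have ig : mu.-integrable setT g.
  apply/integrableP; split => //.
  by under eq_integral do rewrite gee0_abs ?lee_fin ?sqr_ge0//.
have dg : {ae mu, forall t n, setT t -> (`|d_ n t| <= g t)%E}.
  apply: aeW => t n _; rewrite gee0_abs ?lee_fin ?sqr_ge0// !sqr_normcE ReB ImB/=.
  have [->|->] := indic01 n t; first by rewrite !mulr0 !sub0r !sqrrN.
  by rewrite !mulr1 !subrr expr0n addr0 addr_ge0 ?sqr_ge0.
have dc : {ae mu, forall t, setT t -> d_ n t @[n --> \oo] --> 0%E}.
  apply: aeW => t _; apply: cvg_near_cst.
  near=> n; rewrite /d_ sqr_normcE ReB ImB/= indicE mem_set ?mulr1 ?subrr ?expr0n ?addr0//=.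
  by rewrite in_itv/= -ler_norml; near: n; exact: nbhs_infty_ger.
have [_ _] := @dominated_convergence _ (measurableTypeR R) R mu setT measurableT
  d_ (cst 0%E) g md_ (measurable_cst _) dc ig dg.
by rewrite integral0.
Unshelve. all: by end_near. Qed.

Let energy_fourier_integralB_le f g : cintegrable f -> cintegrable g ->
  (energy (fun w => fourier_integral f w - fourier_integral g w)%R <=
   (2 * pi)%:E * energy (fun t => f t - g t)%R)%E.
Proof.
move=> cf cg; have := energy_fourier_integral_le (cintegrableB cf cg).
apply: le_trans; rewrite le_eqVlt; apply/orP; left; apply/eqP.
by apply: eq_integral => w _; rewrite fourier_integralB.
Qed.

Let pi20 : 0 < 2 * pi :> R. Proof. by rewrite mulr_gt0// pi_gt0. Qed.

Let energy_fourier_integral_dist (f_ g_ : nat -> R -> R[i]) h :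
  (forall n, cintegrable (f_ n)) -> (forall n, cintegrable (g_ n)) ->
  (forall n, cmeasurable (f_ n)) -> (forall n, cmeasurable (g_ n)) ->
  cmeasurable h -> cvg_L2 f_ h -> cvg_L2 g_ h ->
  forall e : R, 0 < e -> exists N, forall n m, (N <= n)%N -> (N <= m)%N ->
    (energy (fun w => fourier_integral (f_ n) w - fourier_integral (g_ m) w)%R
     <= e%:E)%E.
Proof.
move=> cf cg mf mg mh fh gh e e0.
have ep0 : 0 < e / (2 * pi) by rewrite divr_gt0.
have [N NP] := cvg_L2_dist mf mg mh fh gh ep0; exists N => n m Nn Nm.
apply: (le_trans (energy_fourier_integralB_le (cf n) (cg m))).
have -> : e%:E = ((2 * pi)%:E * (e / (2 * pi))%:E)%E.
  by rewrite -EFinM; congr EFin; rewrite mulrC divfK// gt_eqF.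
by apply: lee_wpmul2l; [rewrite lee_fin ltW|exact: NP].
Qed.

Let energyD_le F G : cmeasurable F -> cmeasurable G ->
  (energy F <= 2%:E * energy (fun t => G t - F t)%R + 2%:E * energy G)%E.
Proof.
move=> mF mG.
have m0 : cmeasurable (fun=> 0 : R[i]) by split; exact: measurable_cst.
have E0 (H : R -> R[i]) : energy (fun t => H t - 0) = energy H.
  by apply: eq_integral => t _; rewrite subr0.
have := energyB_le mF mG m0.
by rewrite !E0 energyBC.
Qed.

(** The limit is built from the truncations. For any other approximating sequence the transforms
    become close to those of the truncations, by boundedness, and so have the same limit. *)
Lemma is_fourier_exists f : square_integrable f -> exists F, is_fourier f F.
Proof.
move=> sf; have [mf ef] := sf.
have mt n : cmeasurable (truncation n f) by exact: cmeasurable_truncation.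
have ct n : cintegrable (truncation n f) by exact: cintegrable_truncation.
have tf := cvg_truncation sf.
have mT n : cmeasurable (fourier_integral (truncation n f)).
  exact: cmeasurable_fourier_integral.
have [F mF TF] := cL2_complete mT (energy_fourier_integral_dist ct ct mt mt mf tf tf).
exists F; split.
  split => //; have /cvg_L2P/(_ _ ltr01)[N NP] := TF.
  apply: (le_lt_trans (energyD_le mF (mT N))); rewrite lte_add_pinfty//.
    rewrite lte_mul_pinfty//; apply: le_lt_trans (ltry 1); exact: NP.
  rewrite lte_mul_pinfty//; apply: (le_lt_trans (energy_fourier_integral_le (ct N))).
  rewrite lte_mul_pinfty// ?lee_fin ?ltW//.
  by have [] := square_integrable_truncation N sf.
move=> f_ cf_ sf_ ff; have mf_ n : cmeasurable (f_ n) by have [] := sf_ n.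
refine (@cvg_L2_trans R (fun n => fourier_integral (f_ n)) _ F _ mT mF _ TF).
  by move=> n; exact: cmeasurable_fourier_integral.
apply: (cvge0_leP _).2; first by move=> n; exact: energy_ge0.
move=> e e0.
have [N NP] := energy_fourier_integral_dist cf_ ct mf_ mt mf ff tf e0.
by exists N => n Nn; exact: NP.
Qed.

Lemma is_fourier_fourier f : square_integrable f -> is_fourier f (fourier f).
Proof. by move=> /is_fourier_exists[F hF]; apply: (xgetPex (fun=> 0)); exists F. Qed.

(** Both candidates are L^2 limits of one sequence, the transforms of the truncations. *)
Lemma is_fourier_unique f F G : square_integrable f ->
  is_fourier f F -> is_fourier f G -> {ae mu, forall w, F w = G w}.
Proof.
move=> sf [[mF _] fF] [[mG _] fG].
have ct n : cintegrable (truncation n f) by exact: cintegrable_truncation.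
have st n : square_integrable (truncation n f) by exact: square_integrable_truncation.
have tf := cvg_truncation sf.
apply: (cvg_L2_unique _ mF mG (fF _ ct st tf) (fG _ ct st tf)) => n.
exact: cmeasurable_fourier_integral.
Qed.

(** A truncation that covers [[a, b]] does not change the integral over it, while the energy of its
    transform tends to that of [F], which is [0]. The bound [integral_itv_le] then makes the
    integral arbitrarily small. *)
Let integral_itv_eq0 f F (a b : R) : square_integrable f -> is_fourier f F ->
  energy F = 0%E -> a < b ->
  \int[mu]_(t in `[a, b]) complex.Re (f t) = 0 /\
  \int[mu]_(t in `[a, b]) complex.Im (f t) = 0.
Proof.
move=> sf [[mF _] fF] F0 ab.
have ct n : cintegrable (truncation n f) by exact: cintegrable_truncation.
have st n : square_integrable (truncation n f) by exact: square_integrable_truncation.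
have /cvg_L2P cT := fF _ ct st (cvg_truncation sf).
have mT n : cmeasurable (fourier_integral (truncation n f)).
  exact: cmeasurable_fourier_integral.
have main (u : R -> R) : (forall n, mu.-integrable setT (EFin \o (fun t => u t * \1_(I n) t))) ->
    (forall n, transform_energy (fun t => u t * \1_(I n) t)%R <=
      energy (fourier_integral (truncation n f)))%E ->
    \int[mu]_(t in `[a, b]) u t = 0.
  move=> iu tu; apply/eqP; rewrite -normr_le0; apply/ler_addgt0Pr => e e0.
  rewrite add0r -(ler_pM2l pi20).
  have ba0 : 0 < b - a by rewrite subr_gt0.
  (* With this [l] the first term of [integral_itv_le] is [pi * e]. The tolerance [l * (pi * e)],
     doubled by [energyD_le] and divided by [2 * l], also gives [pi * e], for a total of
     [2 * pi * e]. *)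
  pose l := e / (b - a).
  have l0 : 0 < l by rewrite divr_gt0.
  have d0 : 0 < l * (pi * e) by apply: mulr_gt0 => //; apply: mulr_gt0 => //; exact: pi_gt0.
  have [N NP] := cT _ d0.
  have [M Mab] : exists M : nat, (N <= M)%N /\ (- M%:R <= a) && (b <= M%:R).
    have [K HK] : exists K : nat, `|a| + `|b| <= K%:R.
      exists (Num.trunc (`|a| + `|b|)).+1; apply: ltW; apply: truncnS_gt.
    exists (maxn N K); rewrite leq_maxl; split => //.
    have KM : K%:R <= (maxn N K)%:R :> R by rewrite ler_nat leq_maxr.
    have := ler_norm (- a); have := ler_norm b; rewrite normrN.
    have := normr_ge0 a; have := normr_ge0 b.
    by move=> *; apply/andP; split; lra.
  have [NM /andP[aM bM]] := Mab.
  have -> : \int[mu]_(t in `[a, b]) u t = \int[mu]_(t in `[a, b]) (u t * \1_(I M) t).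
    apply: eq_Rintegral => t; rewrite inE/= in_itv/= => /andP[at_ tb].
    by rewrite indicE mem_set ?mulr1//= in_itv/= (le_trans aM)// (le_trans tb).
  rewrite -lee_fin; apply: (le_trans (integral_itv_le ab l0 (iu M))).
  have EM : (energy (fourier_integral (truncation M f)) <= 2%:E * (l * (pi * e))%:E)%E.
    have h := energyD_le (mT M) mF.
    rewrite F0 mule0 adde0 energyBC in h; apply: (le_trans h).
    by apply: lee_wpmul2l; [rewrite lee_fin|exact: NP].
  apply: (@le_trans _ _ ((l * pi * (b - a))%:E + ((2 * l)^-1)%:E * (2%:E * (l * (pi * e))%:E))%E).
    apply: leeD => //; apply: lee_wpmul2l; first by rewrite lee_fin invr_ge0 mulr_ge0// ltW.
    exact: le_trans (tu M) EM.
  rewrite -!EFinM -EFinD lee_fin /l le_eqVlt; apply/orP; left; apply/eqP.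
  by field; rewrite (gt_eqF e0) (gt_eqF ba0).
split; apply: main => n.
- by have [] := ct n.
- by rewrite energy_fourier_integral// leeDl// transform_energy_ge0.
- by have [] := ct n.
- by rewrite energy_fourier_integral// leeDr// transform_energy_ge0.
Qed.

(** Lebesgue differentiation: the primitive of the truncation from [- n%:R] vanishes throughout a
    neighbourhood of each [x] in the open interval, and its derivative is [u x] for almost every
    such [x]. *)
Let ae0_of_integral_itv (u : R -> R) :
  (forall n, mu.-integrable setT (EFin \o (fun t => u t * \1_(I n) t))) ->
  (forall a b, a < b -> \int[mu]_(t in `[a, b]) u t = 0) ->
  {ae mu, forall t, u t = 0}.
Proof.
move=> iu u0.
have step n : {ae mu, forall t, - n%:R < t < n%:R -> u t = 0}.
  pose v t := u t * \1_(I n) t.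
  have iv := iu n.
  have lv : locally_integrable setT v.
    have := integrable_locally measurableT iv.
    by rewrite patch_setT.
  have := @FTC1 R v (BLeft (- n%:R)) _ lv.
  have H y : mu.-integrable [set` Interval (BLeft (- n%:R)) (BRight y)] (EFin \o v).
    by apply: integrableS iv.
  move=> /(_ H).
  apply: (@filterS _ _ (ae_filter_ringOfSetsType mu)) => x h /andP[nx xn].
  move: h; rewrite /= lte_fin => /(_ nx)[_].
  set W := (fun x => _).
  have -> : W^`()%classic x = 0.
    rewrite derive1E (@near_eq_derive _ _ _ _ (cst 0)) ?derive_cst//.
    near=> y.
    have yn : - n%:R < y < n%:R.
      by apply/andP; split; near: y; [exact: lt_nbhsr|exact: lt_nbhsl].
    have /andP[ny ny'] := yn.
    rewrite /W -[RHS](u0 (- n%:R) y ny); apply: eq_Rintegral => t.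
    rewrite inE/= in_itv/= => /andP[nt ty].
    by rewrite /v indicE mem_set ?mulr1//= in_itv/= nt (le_trans ty)// ltW.
  by rewrite /v indicE mem_set ?mulr1//= in_itv/= !ltW.
have := ae_foralln step.
apply: (@filterS _ _ (ae_filter_ringOfSetsType mu)) => t h.
apply: (h (Num.trunc `|t|).+1).
by rewrite -ltr_norml truncnS_gt.
Unshelve. all: by end_near. Qed.

Lemma is_fourier_energy_gt0 f F : square_integrable f -> nonzero f ->
  is_fourier f F -> (0 < energy F)%E.
Proof.
move=> sf nf fF; rewrite lt0e energy_ge0 andbT; apply/eqP => F0; apply: nf.
have ct n := cintegrable_truncation n sf.
have hr : {ae mu, forall t, complex.Re (f t) = 0}.
  apply: ae0_of_integral_itv; first by move=> n; have [] := ct n.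
  by move=> a b ab; have [] := integral_itv_eq0 sf fF F0 ab.
have hi : {ae mu, forall t, complex.Im (f t) = 0}.
  apply: ae0_of_integral_itv; first by move=> n; have [] := ct n.
  by move=> a b ab; have [] := integral_itv_eq0 sf fF F0 ab.
apply: (@filterS2 _ _ (ae_filter_ringOfSetsType mu) _ _ _ _ hr hi) => t.
by case: (f t) => a b /= -> ->.
Qed.

End plancherel.

(** * Scaling *)

Section scaling.
Context {R : realType}.
Local Notation mu := (@lebesgue_measure R).
Implicit Types (f g F G : R -> R[i]).

Let integralZl_gt0 (c : R) (u : R -> \bar R) : 0 < c ->
  measurable_fun setT u ->
  (\int[mu]_t (c%:E * u t) = c%:E * \int[mu]_t u t)%E.
Proof.
move=> c0 mu_; rewrite integralE [in RHS]integralE.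
rewrite -(gt0_muleBr c0); try by apply: integral_ge0 => t _; rewrite ?funepos_ge0 ?funeneg_ge0.
rewrite -!ge0_integralZl_EFin ?ltW//.
- congr (_ - _)%E; apply: eq_integral => t _.
    by rewrite ge0_funeposM// ltW.
  by rewrite ge0_funenegM// ltW.
- exact: measurable_funeneg.
- exact: measurable_funepos.
Qed.

Lemma energy_scale (a : R) f : 0 < a -> cmeasurable f ->
  energy (fun t => f (a * t)) = (a^-1%:E * energy f)%E.
Proof.
move=> a0 mf.
apply: (integral_scale a0 (f := fun t => (normc (f t) ^+ 2)%:E)).
by apply/measurable_EFinP; exact: measurable_sqr_normc.
Qed.

Lemma cmeasurable_scale (a : R) f : cmeasurable f ->
  cmeasurable (fun t => f (a * t)).
Proof.
move=> [f1 f2]; have ma : measurable_fun setT (fun t : R => a * t).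
  by apply: measurable_funM.
split; first exact: (measurableT_comp f1).
exact: (measurableT_comp f2).
Qed.

Lemma square_integrable_scale (a : R) f : 0 < a -> square_integrable f ->
  square_integrable (fun t => f (a * t)).
Proof.
move=> a0 [mf ef]; split; first exact: cmeasurable_scale.
by rewrite energy_scale// lte_mul_pinfty// lee_fin invr_ge0 ltW.
Qed.

Let integrable_scale (a : R) (u : R -> R) : 0 < a ->
  mu.-integrable setT (EFin \o u) ->
  mu.-integrable setT (EFin \o (fun t => u (a * t))).
Proof.
move=> a0 iu; have mu_ := measurable_integrable iu.
have ma : measurable_fun setT (fun t : R => a * t) by apply: measurable_funM.
apply/integrableP; split.
  by apply/measurable_EFinP; exact: (measurableT_comp mu_).
rewrite (integral_scale a0 (f := fun t => `|(u t)%:E|%E)); last first.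
  by apply: measurableT_comp => //; exact/measurable_EFinP.
rewrite lte_mul_pinfty//; first by rewrite lee_fin invr_ge0 ltW.
by case/integrableP : iu.
Qed.

Lemma cintegrable_scale (a : R) f : 0 < a -> cintegrable f ->
  cintegrable (fun t => f (a * t)).
Proof.
by move=> a0 [f1 f2]; split; [exact: (integrable_scale a0 f1)|exact: (integrable_scale a0 f2)].
Qed.

Let cos_transform_scale (a : R) (u : R -> R) w : 0 < a ->
  mu.-integrable setT (EFin \o u) ->
  cos_transform (fun t => u (a * t)) w = a^-1 * cos_transform u (a^-1 * w).
Proof.
move=> a0 iu; rewrite /cos_transform.
rewrite -(Rintegral_scale a0 (f := fun t => u t * cos (a^-1 * w * t))).
  apply: eq_Rintegral => t _; congr (_ * cos _).
  by field; rewrite gt_eqF.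
apply: measurable_funM; first exact: measurable_integrable.
exact: measurable_cosMl.
Qed.

Let sin_transform_scale (a : R) (u : R -> R) w : 0 < a ->
  mu.-integrable setT (EFin \o u) ->
  sin_transform (fun t => u (a * t)) w = a^-1 * sin_transform u (a^-1 * w).
Proof.
move=> a0 iu; rewrite /sin_transform.
rewrite -(Rintegral_scale a0 (f := fun t => u t * sin (a^-1 * w * t))).
  apply: eq_Rintegral => t _; congr (_ * sin _).
  by field; rewrite gt_eqF.
apply: measurable_funM; first exact: measurable_integrable.
exact: measurable_sinMl.
Qed.

Definition dilation (a : R) F : R -> R[i] := fun w =>
  ((a^-1 * complex.Re (F (a^-1 * w))) +i* (a^-1 * complex.Im (F (a^-1 * w))))%C.

Lemma fourier_integral_scale (a : R) f w : 0 < a -> cintegrable f ->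
  fourier_integral (fun t => f (a * t)) w = dilation a (fourier_integral f) w.
Proof.
move=> a0 cf; have [iu iv] := cf.
rewrite fourier_integralE; last exact: cintegrable_scale.
rewrite /dilation fourier_integralE//=.
rewrite (cos_transform_scale w a0 iu) (cos_transform_scale w a0 iv).
rewrite (sin_transform_scale w a0 iu) (sin_transform_scale w a0 iv).
by rewrite mulrDr mulrBr.
Qed.

Lemma cmeasurable_dilation (a : R) F : cmeasurable F -> cmeasurable (dilation a F).
Proof. by move=> /(cmeasurable_scale a^-1)[F1 F2]; split; exact: measurable_funM. Qed.

Lemma sqr_normc_dilation (a : R) F w :
  normc (dilation a F w) ^+ 2 = a^-1 ^+ 2 * normc (F (a^-1 * w)) ^+ 2.
Proof. by rewrite !sqr_normcE/= !exprMn mulrDr. Qed.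

Lemma energy_dilation (a : R) F : 0 < a -> cmeasurable F ->
  energy (dilation a F) = (a^-1%:E * energy F)%E.
Proof.
move=> a0 mF; rewrite /energy.
under eq_integral do rewrite sqr_normc_dilation EFinM.
rewrite ge0_integralZl_EFin ?sqr_ge0//; last 2 first.
- by move=> t _; rewrite lee_fin sqr_ge0.
- apply/measurable_EFinP; apply: measurable_sqr_normc; exact: cmeasurable_scale.
rewrite -/(energy (fun w => F (a^-1 * w))) energy_scale ?invr_gt0//.
rewrite muleA -EFinM invrK; congr (_%:E * _)%E.
by field; rewrite gt_eqF.
Qed.

(** A sequence approaching the scaled signal is scaled back to one approaching [f], where the
    hypothesis on [F] applies. Both energies change by the factor [a^-1], hence the tolerances
    [a^-1 * e] and [a * e]. *)
Lemma is_fourier_scale (a : R) f F : 0 < a -> square_integrable f ->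
  is_fourier f F -> is_fourier (fun t => f (a * t)) (dilation a F).
Proof.
move=> a0 sf [[mF eF] fF]; have [mf ef] := sf.
have ia0 : 0 < a^-1 by rewrite invr_gt0.
have ane : a != 0 by rewrite gt_eqF.
split.
  split; first exact: cmeasurable_dilation.
  by rewrite energy_dilation// lte_mul_pinfty// lee_fin ltW.
move=> h_ ch sh hf.
pose k_ n t := h_ n (a^-1 * t).
have ck n : cintegrable (k_ n) by exact: cintegrable_scale.
have sk n : square_integrable (k_ n) by exact: square_integrable_scale.
have hk n : h_ n = (fun t => k_ n (a * t)).
  by apply/funext => t; rewrite /k_ mulKf.
have kf : cvg_L2 k_ f.
  apply/cvg_L2P => e e0; have /cvg_L2P/(_ (a^-1 * e)) := hf.
  move=> /(_ (mulr_gt0 ia0 e0))[N NP]; exists N => n Nn.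
  have := NP n Nn; rewrite hk.
  have mkf : cmeasurable (fun t => k_ n t - f t).
    by apply: cmeasurableB => //; have [] := sk n.
  by rewrite (energy_scale a0 mkf) EFinM lee_pmul2l// lte_fin.
apply/cvg_L2P => e e0.
have /cvg_L2P/(_ (a * e)) := fF _ ck sk kf.
move=> /(_ (mulr_gt0 a0 e0))[N NP]; exists N => n Nn.
have -> : (fun t => fourier_integral (h_ n) t - dilation a F t) =
    dilation a (fun t => fourier_integral (k_ n) t - F t).
  apply/funext => w; rewrite hk fourier_integral_scale// /dilation.
  by rewrite ReB ImB; apply/eqP; rewrite eq_complex/= !mulrBr !eqxx.
rewrite energy_dilation//; last first.
  by apply: cmeasurableB => //; exact: cmeasurable_fourier_integral.
have -> : e%:E = (a^-1%:E * (a * e)%:E)%E by rewrite -EFinM mulKf.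
by apply: lee_wpmul2l; [rewrite lee_fin ltW|exact: NP].
Qed.

(** * Averages and resolutions of a scaled signal *)

Section moments.
Variables (a : R) (f : R -> R[i]).
Hypotheses (a0 : 0 < a) (sf : square_integrable f).

Let mf : cmeasurable f. Proof. by have [] := sf. Qed.

Let sF : square_integrable (fourier f).
Proof. by have [] := is_fourier_fourier sf. Qed.

Let ia0 : 0 < a^-1. Proof. by rewrite invr_gt0. Qed.

Let ane : a != 0. Proof. by rewrite gt_eqF. Qed.

Let mM (h : R -> R) F : measurable_fun setT h -> cmeasurable F ->
  measurable_fun setT (fun t => (h t * normc (F t) ^+ 2)%:E).
Proof.
move=> mh mF; apply/measurable_EFinP; apply: measurable_funM => //.
exact: measurable_sqr_normc.
Qed.

Let fine_energy_scale : fine (energy (fun t => f (a * t))) = a^-1 * fine (energy f).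
Proof.
rewrite energy_scale// fineM// ge0_fin_numE ?energy_ge0//.
by have [] := sf.
Qed.

Lemma time_average_scale (h : R -> R) : measurable_fun setT h ->
  time_average (fun t => f (a * t)) h = time_average f (fun t => h (a^-1 * t)).
Proof.
move=> mh; rewrite /time_average fine_energy_scale.
have mh' : measurable_fun setT (fun t : R => h (a^-1 * t)).
  by apply: (measurableT_comp mh); apply: measurable_funM.
have -> : (\int[mu]_t (h t * normc (f (a * t)%R) ^+ 2)%:E =
    a^-1%:E * \int[mu]_t (h (a^-1 * t)%R * normc (f t) ^+ 2)%:E)%E.
  rewrite -(integral_scale a0 (mM mh' mf)).
  by apply: eq_integral => t _; rewrite mulKf.
rewrite muleA -EFinM; congr (_%:E * _)%E.
by rewrite invfM invrK mulrAC mulfV// mul1r.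
Qed.

(** The chosen transform of the scaled signal agrees with the dilation only almost everywhere, which
    suffices under the integral. Its square brings [a^-1 ^+ 2], the substitution brings [a], and the
    energy in the denominator cancels the remaining [a^-1]. *)
Lemma frequency_average_scale (h : R -> R) : measurable_fun setT h ->
  frequency_average (fun t => f (a * t)) h =
  frequency_average f (fun w => h (a * w)).
Proof.
move=> mh; rewrite /frequency_average fine_energy_scale.
have sg := square_integrable_scale a0 sf.
have [[mG _] _] := is_fourier_fourier sg; have [mF _] := sF.
have mD := cmeasurable_dilation a mF.
have ae := is_fourier_unique sg (is_fourier_fourier sg)
  (is_fourier_scale a0 sf (is_fourier_fourier sf)).
have mh' : measurable_fun setT (fun t : R => h (a * t)).
  by apply: (measurableT_comp mh); apply: measurable_funM.
have -> : (\int[mu]_w (h w * normc (fourier (fun t => f (a * t)%R) w) ^+ 2)%:E =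
    a^-1%:E * \int[mu]_w (h (a * w)%R * normc (fourier f w) ^+ 2)%:E)%E.
  transitivity (\int[mu]_w (h w * normc (dilation a (fourier f) w) ^+ 2)%:E)%E.
    apply: ae_eq_integral => //; [exact: mM|exact: mM|].
    by apply: (@filterS _ _ (ae_filter_ringOfSetsType mu)) ae => w -> _.
  transitivity (\int[mu]_w ((a^-1 ^+ 2)%:E * (h w * normc (fourier f (a^-1 * w)%R) ^+ 2)%:E))%E.
    by apply: eq_integral => w _; rewrite sqr_normc_dilation -EFinM mulrCA.
  rewrite integralZl_gt0 ?exprn_gt0//; last first.
    by apply: mM => //; exact: cmeasurable_scale.
  have := integral_scale ia0 (mM mh' mF); rewrite invrK.
  under eq_integral do rewrite mulVKf//.
  move=> ->; rewrite muleA -EFinM; congr (_%:E * _)%E.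
  by rewrite expr2 -mulrA mulVf// mulr1.
rewrite muleA -EFinM; congr (_%:E * _)%E.
by rewrite mulrCA invfM invrK mulrAC mulfV// mul1r.
Qed.

Let time_averageZ (c : R) (h : R -> R) : 0 < c -> measurable_fun setT h ->
  time_average f (fun t => c * h t) = (c%:E * time_average f h)%E.
Proof.
move=> c0 mh; rewrite /time_average muleCA; congr (_ * _)%E.
under eq_integral do rewrite -mulrA EFinM.
by rewrite integralZl_gt0//; exact: mM.
Qed.

Let frequency_averageZ (c : R) (h : R -> R) : 0 < c -> measurable_fun setT h ->
  frequency_average f (fun t => c * h t) = (c%:E * frequency_average f h)%E.
Proof.
move=> c0 mh; rewrite /frequency_average muleCA; congr (_ * _)%E.
under eq_integral do rewrite -mulrA EFinM.
by rewrite integralZl_gt0//; apply: mM => //; have [] := sF.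
Qed.

Let fine_mule (c : R) (x : \bar R) : 0 < c -> fine (c%:E * x) = c * fine x.
Proof.
move=> c0; have ce : (0 < c%:E)%E by rewrite lte_fin.
case: x => [x| |] //=; first by rewrite gt0_muley//= mulr0.
by rewrite gt0_muleNy//= mulr0.
Qed.

Let sqrteZ (c : R) (x : \bar R) : 0 < c ->
  sqrte ((c ^+ 2)%:E * x) = (c%:E * sqrte x)%E.
Proof.
move=> c0; rewrite sqrteM ?lee_fin ?sqr_ge0//=.
by rewrite sqrtr_sqr gtr0_norm.
Qed.

Let msqrB (m : R) : measurable_fun setT (fun t : R => (t - m) ^+ 2).
Proof. by apply: measurable_funX; exact: measurable_funB. Qed.

(** The mean is multiplied by [a^-1] like the variable, and so is the default [0] that [fine] gives
    for an infinite mean; the square of [a^-1] therefore factors out in every case. *)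
Lemma time_resolution_scale :
  time_resolution (fun t => f (a * t)) = (a^-1%:E * time_resolution f)%E.
Proof.
rewrite /time_resolution -sqrteZ//; congr sqrte.
rewrite time_average_scale// -time_averageZ ?exprn_gt0//.
rewrite /time_moment (time_average_scale (h := fun t => t ^+ 1)); last exact: measurable_funX.
rewrite (time_averageZ ia0 (h := fun t => t ^+ 1)); last exact: measurable_funX.
rewrite fine_mule//; congr time_average.
by apply/funext => t; rewrite -exprMn mulrBr.
Qed.

Lemma frequency_resolution_scale :
  frequency_resolution (fun t => f (a * t)) = (a%:E * frequency_resolution f)%E.
Proof.
rewrite /frequency_resolution -sqrteZ//; congr sqrte.
rewrite frequency_average_scale// -frequency_averageZ ?exprn_gt0//.
rewrite /frequency_moment (frequency_average_scale (h := fun w => w ^+ 1));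
  last exact: measurable_funX.
rewrite (frequency_averageZ a0 (h := fun w => w ^+ 1)); last exact: measurable_funX.
rewrite fine_mule//; congr frequency_average.
by apply/funext => t; rewrite -exprMn mulrBr.
Qed.

End moments.

(** The weight [(t - m) ^+ 2] vanishes at the single point [m] only, so a null integral leaves no
    mass elsewhere. *)
Let ae0_of_second_moment (m : R) F : cmeasurable F ->
  (\int[mu]_t ((t - m) ^+ 2 * normc (F t) ^+ 2)%:E = 0)%E ->
  {ae mu, forall t, F t = 0}.
Proof.
move=> mF F0.
have mn : measurable_fun setT (fun t : R => ((t - m) ^+ 2 * normc (F t) ^+ 2)%:E).
  apply/measurable_EFinP; apply: measurable_funM.
    by apply: measurable_funX; exact: measurable_funB.
  exact: measurable_sqr_normc.
have /(ae_eq_integral_abs mu measurableT mn) :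
    (\int[mu]_t `|((t - m) ^+ 2 * normc (F t) ^+ 2)%:E| = 0)%E.
  rewrite -[RHS]F0; apply: eq_integral => t _.
  by rewrite gee0_abs// lee_fin mulr_ge0 ?sqr_ge0.
have ne : {ae mu, forall t : R, t != m}.
  exists [set m]; split => //; first by rewrite lebesgue_measure_set1.
  by move=> s /= /negP; rewrite negbK => /eqP.
apply: (@filterS2 _ _ (ae_filter_ringOfSetsType mu) _ _ _ _ ne) => t tm /(_ I) [] /eqP.
by rewrite mulf_eq0 !sqrf_eq0 subr_eq0 (negbTE tm)/= => /eqP; exact: eq0_normc.
Qed.

Let energy_gt0 f : cmeasurable f -> nonzero f -> (0 < energy f)%E.
Proof.
move=> mf nf; rewrite lt0e energy_ge0 andbT; apply/eqP => f0; apply: nf.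
exact: energy0_ae.
Qed.

Lemma energy_eq0 f : cmeasurable f -> {ae mu, forall t, f t = 0} ->
  energy f = 0%E.
Proof.
move=> mf f0; rewrite -(integral0 mu setT); apply: ae_eq_integral => //.
  by apply/measurable_EFinP; exact: measurable_sqr_normc.
by apply: (@filterS _ _ (ae_filter_ringOfSetsType mu)) f0 => t -> _; rewrite normc0 expr0n.
Qed.

Let sqrte_gt0 (x : \bar R) : (0 < x)%E -> (0 < sqrte x)%E.
Proof. by case: x => [x| |]//=; rewrite !lte_fin sqrtr_gt0. Qed.

Lemma time_resolution_gt0 f : square_integrable f -> nonzero f ->
  (0 < time_resolution f)%E.
Proof.
move=> [mf ef] nf; have E0 := energy_gt0 mf nf.
apply: sqrte_gt0; rewrite mule_gt0//.
  by rewrite lte_fin invr_gt0 fine_gt0// E0.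
rewrite lt0e; apply/andP; split; last first.
  by apply: integral_ge0 => t _; rewrite lee_fin mulr_ge0 ?sqr_ge0.
by apply/eqP => /(ae0_of_second_moment mf).
Qed.

(** A zero spread would make [fourier f] vanish almost everywhere, against the injectivity of the
    transform. *)
Lemma frequency_resolution_gt0 f : square_integrable f -> nonzero f ->
  (0 < frequency_resolution f)%E.
Proof.
move=> sf nf; have [mf ef] := sf; have E0 := energy_gt0 mf nf.
have fF := is_fourier_fourier sf; have [[mF _] _] := fF.
apply: sqrte_gt0; rewrite mule_gt0//.
  by rewrite lte_fin invr_gt0 mulr_gt0 ?mulr_gt0 ?pi_gt0// fine_gt0// E0.
rewrite lt0e; apply/andP; split; last first.
  by apply: integral_ge0 => t _; rewrite lee_fin mulr_ge0 ?sqr_ge0.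
apply/eqP => /(ae0_of_second_moment mF) /(energy_eq0 mF) F0.
by have := is_fourier_energy_gt0 sf nf fF; rewrite F0 ltxx.
Qed.

(** Arguing through the energy, which scales by [a^-1], avoids transporting null sets along the
    dilation. *)
Lemma nonzero_scale (a : R) f : 0 < a -> cmeasurable f -> nonzero f ->
  nonzero (fun t => f (a * t)).
Proof.
move=> a0 mf nf /(energy_eq0 (cmeasurable_scale a mf)).
rewrite energy_scale// => /eqP; rewrite mule_eq0 eqe invr_eq0 gt_eqF//=.
by rewrite gt_eqF// energy_gt0.
Qed.

End scaling.

Theorem proposition9 (R : realType) (psi : R -> R[i])
    (psiL2 : square_integrable psi) (psi_neq0 : nonzero psi)
    (fin_t : time_resolution psi \is a fin_num)
    (fin_w : frequency_resolution psi \is a fin_num) :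
  isoresolution (fun t : R =>
    psi (Num.sqrt (fine (time_resolution psi) /
                   fine (frequency_resolution psi)) * t)).
Proof.
have t0 := time_resolution_gt0 psiL2 psi_neq0.
have w0 := frequency_resolution_gt0 psiL2 psi_neq0.
have ft0 : 0 < fine (time_resolution psi).
  by rewrite fine_gt0// t0 ltey_eq fin_t.
have fw0 : 0 < fine (frequency_resolution psi).
  by rewrite fine_gt0// w0 ltey_eq fin_w.
set a := Num.sqrt _.
(* Both positivity lemmas enter here: were either resolution [0], the convention [x / 0 = 0] or the
   zero numerator would give [a = 0] and a constant signal. *)
have a0 : 0 < a by rewrite sqrtr_gt0 divr_gt0.
split.
- exact: square_integrable_scale.
- by apply: nonzero_scale => //; have [] := psiL2.
- by rewrite time_resolution_scale// fin_numM.
rewrite time_resolution_scale// frequency_resolution_scale//.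
rewrite -(fineK fin_t) -(fineK fin_w) -!EFinM; congr EFin.
have a2 : a ^+ 2 = fine (time_resolution psi) / fine (frequency_resolution psi).
  by rewrite sqr_sqrtr// divr_ge0// ltW.
(* Multiplied by [a], the claim says that the time resolution of [psi] is [a ^+ 2] times its
   frequency resolution. *)
apply: (mulfI (lt0r_neq0 a0)); rewrite mulVKf ?gt_eqF// mulrA -expr2 a2.
by rewrite divfK// gt_eqF.
Qed.
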